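(* Let $X$ be a set, let $k$ be a kernel on $X$ and let $s$ be a normalized complete Nevanlinna--Pick kernel on $X$ such that $k/s \ge 0$. Let $\mathcal{E}$ be a Hilbert space and let $\mathcal{M} \subset \mathcal{H}_k \otimes \mathcal{E}$ be a non-zero closed subspace. The following are equivalent: (i) The subspace $\mathcal{M}$ is $\operatorname{Mult}(\mathcal{H}_s)$-invariant. (ii) There exist a Hilbert space $\mathcal{F}$ and a partially isometric multiplier $\Phi \in \operatorname{Mult}(\mathcal{H}_s \otimes \mathcal{F}, \mathcal{H}_k \otimes \mathcal{E})$ such that $\mathcal{M} = \Phi \cdot (\mathcal{H}_s \otimes \mathcal{F})$.
   Context: All Hilbert spaces are complex. A kernel on a set $X$ is a positive semi-definite function $k : X \times X \to \mathbb{C}$, i.e. the matrix $[k(x_i,x_j)]$ is positive semi-definite for every finite subset $\{x_1,\dots,x_n\} \subset X$; this is written $k \ge 0$. $\mathcal{H}_k$ denotes the reproducing kernel Hilbert space on $X$ with kernel $k$, so $\langle f, k(\cdot,x)\rangle = f(x)$ for $f \in \mathcal{H}_k$, $x \in X$. $\operatorname{Mult}(\mathcal{H}_k)$ is the algebra of functions $\varphi : X \to \mathbb{C}$ with $\varphi \mathcal{H}_k \subset \mathcal{H}_k$, and $M_\varphi$ is the corresponding multiplication operator. A kernel $s$ is normalized if there is $x_0 \in X$ with $s(x,x_0) = 1$ for all $x \in X$. A normalized kernel $s$ is a complete Nevanlinna--Pick kernel if and only if $s$ is non-vanishing and $1 - 1/s \ge 0$ (this may be taken as the definition). Here $1/s$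 and $k/s$ denote pointwise quotients on $X \times X$. For a Hilbert space $\mathcal{E}$, elements of $\mathcal{H}_k \otimes \mathcal{E}$ are regarded as $\mathcal{E}$-valued functions on $X$. For kernels $\ell, k$ on $X$ and Hilbert spaces $\mathcal{F}, \mathcal{E}$, $\operatorname{Mult}(\mathcal{H}_\ell \otimes \mathcal{F}, \mathcal{H}_k \otimes \mathcal{E})$ is the space of functions $\Phi : X \to \mathcal{B}(\mathcal{F},\mathcal{E})$ that multiply $\mathcal{H}_\ell \otimes \mathcal{F}$ into $\mathcal{H}_k \otimes \mathcal{E}$ (pointwise: $(\Phi f)(x) = \Phi(x) f(x)$). Such $\Phi$ is called contractive (respectively partially isometric) if the multiplication operator $M_\Phi : \mathcal{H}_\ell \otimes \mathcal{F} \to \mathcal{H}_k \otimes \mathcal{E}$ is contractive (respectively a partial isometry). $\Phi \cdot (\mathcal{H}_\ell \otimes \mathcal{F})$ denotes the range of $M_\Phi$. If $k/s \ge 0$, then $\operatorname{Mult}(\mathcal{H}_s) \subset \operatorname{Mult}(\mathcal{H}_k)$ contractively; a subspace $\mathcal{M} \subset \mathcal{H}_k \otimes \mathcal{E}$ is $\operatorname{Mult}(\mathcal{H}_s)$-invariant if $(M_\varphi \otimes I)\mathcal{M} \subset \mathcal{M}$ for all $\varphi \in \operatorname{Mult}(\mathcal{H}_s)$. *)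

(* Defs.v *)
From HB Require Import structures.
From mathcomp Require Import all_boot all_order all_algebra.
From mathcomp Require Import complex.
From mathcomp Require Import all_classical all_reals all_analysis.

Set Implicit Arguments.
Unset Strict Implicit.
Unset Printing Implicit Defensive.

Import Order.TTheory GRing.Theory Num.Theory.
Import numFieldNormedType.Exports.

Local Open Scope classical_set_scope.
Local Open Scope ring_scope.
Local Open Scope complex_scope.

(* [{dot V for conjC}] is linear in its first argument and conjugate-linear in
   its second one. *)
HB.mixin Record isHilbert (R : realType) V of CompleteNormedModule R[i] V := {
  hdot : {dot V for @Num.conj R[i]} ;
  hdot_norm : forall u : V, `|u| ^+ 2 = hdot u u }.

#[short(type="hilbertType")]
HB.structure Definition Hilbert (R : realType) :=
  { V of isHilbert R V & CompleteNormedModule R[i] V }.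

Definition psd_kernel (R : realType) (X : Type) (k : X -> X -> R[i]) : Prop :=
  forall (n : nat) (x : 'I_n -> X) (c : 'I_n -> R[i]),
    0 <= \sum_(i < n) \sum_(j < n) c i * k (x i) (x j) * Num.conj (c j).

Definition normalized (R : realType) (X : Type) (s : X -> X -> R[i]) : Prop :=
  exists x0, forall x, s x x0 = 1.

Definition normalized_cnp (R : realType) (X : Type) (s : X -> X -> R[i]) : Prop :=
  [/\ psd_kernel s, normalized s, (forall x y, s x y != 0) &
      psd_kernel (fun x y => 1 - (s x y)^-1)].

(* The elements of [H_k] are identified with functions on [X] through the
   injective linear map [rkhs_eval].  Such a space is unique up to the unitary
   that commutes with [rkhs_eval]. *)
Record rkhs (R : realType) (X : Type) (k : X -> X -> R[i]) := RKHS {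
  rkhs_space :> hilbertType R ;
  rkhs_eval : rkhs_space -> X -> R[i] ;
  rkhs_eval_linear : forall x, scalar (fun f => rkhs_eval f x) ;
  rkhs_eval_inj : injective rkhs_eval ;
  rkhs_kernel : X -> rkhs_space ;
  rkhs_kernelE : forall x y, rkhs_eval (rkhs_kernel y) x = k x y ;
  rkhs_reproducing : forall f x, hdot f (rkhs_kernel x) = rkhs_eval f x }.

Arguments rkhs_eval {R X k} H f x : rename.

(* The Hilbert space tensor product, characterized up to unitary equivalence:
   elementary tensors have the product inner product and span a dense
   subspace. *)
Record hilbert_tensor (R : realType) (H K : hilbertType R) := HilbertTensor {
  tensor_space :> hilbertType R ;
  tens : {bilinear H -> K -> tensor_space} ;
  tens_dot : forall f g u v,
    hdot (tens f u) (tens g v) = hdot f g * hdot u v ;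
  tens_dense : closure [set t | exists n (f : 'I_n -> H) (u : 'I_n -> K),
    t = \sum_(i < n) tens (f i) (u i)] = setT }.

Arguments tens {R H K} T : rename.

(* [H_k (x) E] with its elements regarded as [E]-valued functions: evaluation
   at [x] is the bounded operator [(f |-> f x) (x) I], which is determined by
   its values on elementary tensors. *)
Record rkhs_tensor (R : realType) (X : Type) (k : X -> X -> R[i]) (H : rkhs k)
    (E : hilbertType R) := RKHSTensor {
  rkhs_tensor_space :> hilbert_tensor H E ;
  tensor_eval : rkhs_tensor_space -> X -> E ;
  tensor_eval_linear : forall x, linear (fun t => tensor_eval t x) ;
  tensor_eval_continuous : forall x, continuous (fun t => tensor_eval t x) ;
  tensor_evalE : forall f u x,
    tensor_eval (tens rkhs_tensor_space f u) x = rkhs_eval H f x *: u }.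

Arguments tensor_eval {R X k H E} T t x : rename.

(* In the next two definitions [ev1] and [ev2] are the evaluation maps through
   which the elements of [H1] and [H2] are regarded as functions. *)
Definition multiplier (R : realType) (X V1 V2 : Type) (H1 H2 : hilbertType R)
    (ev1 : H1 -> X -> V1) (ev2 : H2 -> X -> V2) (Phi : X -> V1 -> V2) : Prop :=
  forall f : H1, exists g : H2, forall x, ev2 g x = Phi x (ev1 f x).

(* When [Phi] is a multiplier and [ev2] is injective this is the unique [g]
   with [g x = Phi x (f x)] for all [x]; the default [0] is then unused. *)
Definition mulop (R : realType) (X V1 V2 : Type) (H1 H2 : hilbertType R)
    (ev1 : H1 -> X -> V1) (ev2 : H2 -> X -> V2) (Phi : X -> V1 -> V2)
    (f : H1) : H2 :=
  xget 0 [set g | forall x, ev2 g x = Phi x (ev1 f x)].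

Definition Mult (R : realType) (X : Type) (k : X -> X -> R[i]) (H : rkhs k) :
    set (X -> R[i]) :=
  [set phi | multiplier (rkhs_eval H) (rkhs_eval H)
               (fun x z => phi x * z)].

Definition Mop (R : realType) (X : Type) (k : X -> X -> R[i]) (H : rkhs k)
    (phi : X -> R[i]) : H -> H :=
  mulop (rkhs_eval H) (rkhs_eval H) (fun x z => phi x * z).

(* [A] is the operator [M_phi (x) I]; it is determined by its values on
   elementary tensors.  It is part of the condition that [phi] multiplies [H_k]
   and that [M_phi (x) I] exists, which is automatic when [k / s >= 0]. *)
Definition Mult_invariant (R : realType) (X : Type) (s k : X -> X -> R[i])
    (Hs : rkhs s) (Hk : rkhs k) (E : hilbertType R) (T : rkhs_tensor Hk E)
    (M : set T) : Prop :=
  forall phi, Mult Hs phi -> Mult Hk phi /\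
    exists A : {linear T -> T},
      [/\ continuous A,
          forall f u, A (tens T f u) = tens T (Mop phi f) u &
          A @` M `<=` M].

Definition partial_isometry (R : realType) (H1 H2 : hilbertType R)
    (V : H1 -> H2) : Prop :=
  [/\ linear V, continuous V &
      forall f, (forall g, V g = 0 -> hdot f g = 0) -> `|V f| = `|f|].

Definition closed_subspace (R : realType) (H : hilbertType R) (M : set H) :
    Prop :=
  [/\ closed M, M 0 &
      forall (a : R[i]) u v, M u -> M v -> M (a *: u + v)].

(* Main.v *)
Require Import Defs.
From HB Require Import structures.
From mathcomp Require Import all_boot all_order all_algebra.
From mathcomp Require Import complex.
From mathcomp Require Import all_classical all_reals all_analysis.
From mathcomp Require Import ring.

(** The argument rests on one identity between kernels.  Let P be the
    projection onto M and let K_M be the operator-valued reproducing kernel of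
    M, represented here by the Gram matrix of the vectors P (k_x (x) u).  A
    function Phi gives a partial isometry with range M exactly when
    K_M (x, y) = Phi(x) s(x, y) Phi(y)^*, that is, when K_M / s is factored as
    Phi(x) Phi(y)^*.  Such a factorization exists as soon as K_M / s is positive
    semi-definite, because every positive semi-definite kernel is a Gram matrix
    ([kolmogorov]); [beurling_factor] carries this out.

    That K_M / s is positive semi-definite for invariant M ([defect_psd]) is
    where the Nevanlinna-Pick property enters.  On any finite set of points
    the kernel 1 - 1/s is a finite sum of products b(x) conj b(y), with a
    positive semi-definite remainder on all of X ([cholesky]).  Each b is a
    multiplier of H_s, and together they form a row contraction on
    H_k (x) E because k / s is positive semi-definite.  The row maps
    the direct sum of copies of M into M, hence its restriction is a
    contraction too, and contractivity of the adjoint of the restriction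
    ([row_contractive]) is positivity of K_M (1 - sum of b b^* ), which equals
    K_M / s at the chosen points.

    Conversely the range of a multiplier Phi is invariant because Phi commutes
    with scalar multiplication ([range_invariant]), once it is known that a
    multiplier phi of H_s also multiplies H_k (x) E.  By the uniform
    boundedness principle phi is bounded, so (c^2 - phi phi^* ) s is positive
    semi-definite for some c ([MultP]); the Schur product with k / s gives the
    same for k.

    The Hilbert space theory consists of two constructions.  The Riesz
    representation theorem is proved for functions on a family of vectors
    ([riesz_family]).  The Hilbert space of a kernel is the dual of the span
    of the kernel functions, and yields both the coefficient space F and the
    tensor product H_s (x) F ([hilbert_tensor_exists]). *)

Set Implicit Arguments.
Unset Strict Implicit.
Unset Printing Implicit Defensive.

Import Order.TTheory GRing.Theory Num.Theory.
Import numFieldNormedType.Exports.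

Local Open Scope classical_set_scope.
Local Open Scope ring_scope.

(** * Formal combinations *)

Section FormalCombinations.
Variables (R : realType) (Z : Type).
Local Notation C := R[i].
Implicit Types (l v w : seq (C * Z)) (f : Z -> C) (a : C).

(** A list of pairs (a, z) is a formal linear combination of points of [Z].
    Lists serve as the vectors of the span of a family: bounds that hold for
    all lists make sense without knowing that the family is independent. *)
Definition comb (U : lmodType C) (kap : Z -> U) l : U :=
  \sum_(p <- l) p.1 *: kap p.2.

(** Conjugated coefficients make [pair f l] the inner product
    <f, comb kap l> whenever f z = <f, kap z>. *)
Definition pair f l : C := \sum_(p <- l) p.1^* * f p.2.

Definition scal a l : seq (C * Z) := [seq (a * p.1, p.2) | p <- l].

Lemma comb_nil (U : lmodType C) (kap : Z -> U) : comb kap [::] = 0.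
Proof. exact: big_nil. Qed.

Lemma comb1 (U : lmodType C) (kap : Z -> U) a z :
  comb kap [:: (a, z)] = a *: kap z.
Proof. exact: big_seq1. Qed.

Lemma comb_cat (U : lmodType C) (kap : Z -> U) v w :
  comb kap (v ++ w) = comb kap v + comb kap w.
Proof. exact: big_cat. Qed.

Lemma comb_scal (U : lmodType C) (kap : Z -> U) a v :
  comb kap (scal a v) = a *: comb kap v.
Proof.
by rewrite /comb big_map scaler_sumr; apply: eq_bigr => p _; rewrite scalerA.
Qed.

Lemma comb_fctE (Y : Type) (K : Z -> Y -> C) l y :
  comb (K : Z -> (Y -> C)) l y = \sum_(p <- l) p.1 * K p.2 y.
Proof. by rewrite /comb fct_sumE; apply: eq_bigr. Qed.

Lemma pair_nil f : pair f [::] = 0.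
Proof. exact: big_nil. Qed.

Lemma pair1 f a z : pair f [:: (a, z)] = a^* * f z.
Proof. exact: big_seq1. Qed.

Lemma pair_cat f v w : pair f (v ++ w) = pair f v + pair f w.
Proof. exact: big_cat. Qed.

Lemma pair_scal f a v : pair f (scal a v) = a^* * pair f v.
Proof.
rewrite /pair big_map mulr_sumr; apply: eq_bigr => p _.
by rewrite rmorphM /= mulrA.
Qed.

Lemma pairD f g l : pair (f + g) l = pair f l + pair g l.
Proof. by rewrite /pair -big_split /=; apply: eq_bigr => p _; rewrite mulrDr. Qed.

Lemma pairZ a f l : pair (a *: f) l = a * pair f l.
Proof.
by rewrite /pair mulr_sumr; apply: eq_bigr => p _; rewrite mulrCA.
Qed.

Lemma pairN f l : pair (- f) l = - pair f l.
Proof. by rewrite -scaleN1r pairZ mulN1r. Qed.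

Lemma pairB f g l : pair (f - g) l = pair f l - pair g l.
Proof. by rewrite pairD pairN. Qed.

Lemma pair_comb (K : Z -> Z -> C) v w :
  pair (comb (K : Z -> (Z -> C)) v) w =
  \sum_(p <- v) \sum_(q <- w) p.1 * K p.2 q.2 * q.1^*.
Proof.
rewrite exchange_big /=; apply: eq_bigr => q _.
by rewrite comb_fctE mulr_sumr; apply: eq_bigr => p _; rewrite mulrC.
Qed.

(** Linear in the left list and conjugate-linear in the right one; for a Gram
    matrix it is the inner product of the two combinations, see [form_gram]. *)
Definition form (K : Z -> Z -> C) v w : C := pair (comb (K : Z -> (Z -> C)) v) w.

Lemma psd_kernelP (K : Z -> Z -> C) :
  psd_kernel K <-> forall l, 0 <= form K l l.
Proof.
split=> [H l|H n x c].
  rewrite /form pair_comb.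
  have := H (size l) (fun i => (tnth (in_tuple l) i).2)
                     (fun i => (tnth (in_tuple l) i).1).
  rewrite [X in _ -> 0 <= X]big_tnth; under [X in _ -> 0 <= X]eq_bigr do rewrite big_tnth.
  by [].
have := H [seq (c i, x i) | i <- enum 'I_n].
rewrite /form pair_comb big_map big_enum /=.
by under eq_bigr do rewrite big_map big_enum /=.
Qed.

End FormalCombinations.

(** * Positive semi-definite kernels *)

Section Forms.
Variables (R : realType) (Z : Type).
Local Notation C := R[i].
Implicit Types (K : Z -> Z -> C) (v w : seq (C * Z)) (a : C).

Lemma form_catl K u v w : form K (u ++ v) w = form K u w + form K v w.
Proof. by rewrite /form comb_cat pairD. Qed.

Lemma form_catr K u v w : form K u (v ++ w) = form K u v + form K u w.
Proof. exact: pair_cat. Qed.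

Lemma form_scall K a v w : form K (scal a v) w = a * form K v w.
Proof. by rewrite /form comb_scal pairZ. Qed.

Lemma form_scalr K a v w : form K v (scal a w) = a^* * form K v w.
Proof. exact: pair_scal. Qed.

Lemma form1r K v a z :
  form K v [:: (a, z)] = a^* * comb (K : Z -> (Z -> C)) v z.
Proof. exact: pair1. Qed.

Lemma form11 K a b z z' : form K [:: (a, z)] [:: (b, z')] = a * b^* * K z z'.
Proof. by rewrite form1r comb1 mulrA [X in _ = X * _]mulrC -mulrA. Qed.

(** Polarization: with x = <v, w> and y = <w, v>, the two reality conditions
    come from the quadratic form at v + w and at i v + w. *)
Lemma conjC_sym (x y : C) : x + y \is Num.real -> 'i * (x - y) \is Num.real ->
  x^* = y.
Proof.
move=> /CrealP + /CrealP; rewrite !(rmorphM, rmorphD, rmorphN) /= conjCi mulNr -mulrN.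
move=> e1 /(mulfI (neq0Ci _)) e2.
apply: (mulIf (_ : 2 != 0 :> C)); first by rewrite pnatr_eq0.
have -> : x^* * 2 = (x^* + y^*) + (x^* - y^*) by ring.
rewrite e1 -[x^* - y^*]opprK e2; ring.
Qed.

Lemma form_conj K v w : psd_kernel K -> (form K v w)^* = form K w v.
Proof.
move=> /psd_kernelP K0; apply: conjC_sym.
  rewrite (_ : _ + _ = form K (v ++ w) (v ++ w) - form K v v - form K w w).
    by rewrite !rpredB ?ger0_real.
  by rewrite form_catl !form_catr; ring.
pose u := scal 'i v.
rewrite (_ : _ * _ = form K (u ++ w) (u ++ w) - form K u u - form K w w).
  by rewrite !rpredB ?ger0_real.
rewrite form_catl !form_catr !form_scall !form_scalr conjCi; ring.
Qed.

Lemma psd_conj K z z' : psd_kernel K -> (K z z')^* = K z' z.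
Proof.
move=> /(form_conj [:: (1, z)] [:: (1, z')]).
by rewrite !form11 conjC1 !mul1r.
Qed.

Lemma form_perturb K v w (t : C) : psd_kernel K ->
  form K (v ++ scal t w) (v ++ scal t w) =
  form K v v + (t^* * form K v w + t * (form K v w)^*) + `|t| ^+ 2 * form K w w.
Proof.
move=> K0; rewrite form_catl !form_catr !form_scall !form_scalr.
by rewrite form_conj // normCK; ring.
Qed.

(** The one optimization behind both the Cauchy-Schwarz inequality and the
    variational argument below: for n > 0 the choice t = al / n is optimal,
    and for n = 0 the left-hand side is unbounded in t unless al = 0. *)
Lemma quadratic_bound (al n e : C) : 0 <= n -> 0 <= e ->
    (forall t, t^* * al + t * al^* - `|t| ^+ 2 * n <= e) ->
  `|al| ^+ 2 <= e * n.
Proof.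
rewrite le_eqVlt => /predU1P[<-|n0] e0 H; last first.
  have := H (al / n); rewrite rmorphM fmorphV /= normrM exprMn normfV.
  rewrite (ger0_norm (ltW n0)) (CrealP (ger0_real (ltW n0))) normCK.
  rewrite (_ : _ - _ = al * al^* / n); last by field; rewrite gt_eqF.
  by rewrite ler_pdivrMr.
have [->|al0] := eqVneq al 0; first by rewrite normr0 expr0n mulr0.
have pos : 0 < `|al| ^+ 2 by rewrite exprn_gt0 // normr_gt0.
set c := (e + 1) / `|al| ^+ 2.
have c0 : 0 <= c by rewrite divr_ge0 ?addr_ge0 // ltW.
have := H (c * al); rewrite mulr0 subr0 rmorphM /= geC0_conj //.
rewrite (_ : _ + _ = c * (al * al^*) *+ 2); last by ring.
rewrite -normCK divfK ?gt_eqF // -subr_le0 (_ : _ - _ = e + 2); last by ring.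
by rewrite real_leNgt ?ger0_real ?addr_ge0 // ltr_wpDl.
Qed.

Lemma form_cauchy_schwarz K v w : psd_kernel K ->
  `|form K v w| ^+ 2 <= form K v v * form K w w.
Proof.
move=> K0; have /psd_kernelP Kge0 := K0; apply: quadratic_bound => // t.
rewrite -subr_ge0; have := Kge0 (v ++ scal (- t) w).
rewrite form_perturb // normrN rmorphN /=; congr (0 <= _); ring.
Qed.

Lemma psd_conjT K : psd_kernel K -> psd_kernel (fun x y => K y x).
Proof.
move=> K0 n x c; have := K0 n x (fun i => (c i)^*).
rewrite exchange_big; congr (0 <= _); apply: eq_bigr => i _.
by apply: eq_bigr => j _; rewrite conjCK; ring.
Qed.

Lemma psd_pull (Y : Type) (g : Y -> Z) K :
  psd_kernel K -> psd_kernel (fun x y => K (g x) (g y)).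
Proof. by move=> K0 n x c; apply: (K0 n (g \o x) c). Qed.

Lemma psd_add K L : psd_kernel K -> psd_kernel L ->
  psd_kernel (fun x y => K x y + L x y).
Proof.
move=> K0 L0 n x c; have := addr_ge0 (K0 n x c) (L0 n x c).
rewrite -big_split; congr (0 <= _); apply: eq_bigr => i _ /=.
by rewrite -big_split; apply: eq_bigr => j _ /=; ring.
Qed.

Lemma psd_rank1 (f : Z -> C) : psd_kernel (fun x y => f x * (f y)^*).
Proof.
move=> n x c; pose a := \sum_i c i * f (x i).
suff -> : \sum_(i < n) \sum_(j < n) c i * (f (x i) * (f (x j))^*) * (c j)^* =
          a * a^* by exact: mul_conjC_ge0.
rewrite rmorph_sum /= mulr_suml; apply: eq_bigr => i _.
rewrite mulr_sumr; apply: eq_bigr => j _.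
by rewrite rmorphM /=; ring.
Qed.

Lemma psd_one : psd_kernel (fun _ _ : Z => 1 : C).
Proof.
have := psd_rank1 (fun _ : Z => 1 : C); congr psd_kernel.
by apply/funext => x; apply/funext => y; rewrite conjC1 mulr1.
Qed.

Lemma psd_sum_rank1 (bs : seq (Z -> C)) :
  psd_kernel (fun x y => \sum_(b <- bs) b x * (b y)^*).
Proof.
elim: bs => [|b bs IH].
  move=> n x c; rewrite big1 // => i _; rewrite big1 // => j _.
  by rewrite big_nil mulr0 mul0r.
have := psd_add (psd_rank1 b) IH; congr psd_kernel.
by apply/funext => x; apply/funext => y; rewrite big_cons.
Qed.

(** A Schur complement.  Its quadratic form at v is the minimum of the
    quadratic form of [K] over v + t z0, which by Cauchy-Schwarz is
    nonnegative; when K z0 z0 = 0 the subtracted term is 0 because 0 has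
    inverse 0. *)
Lemma psd_sub_rank1 K z0 : psd_kernel K ->
  psd_kernel (fun x y => K x y - K x z0 * (K z0 z0)^-1 * K z0 y).
Proof.
move=> K0; have /psd_kernelP Kge0 := K0; apply/psd_kernelP => l.
have D0 := Kge0 [:: (1, z0)]; have CS := form_cauchy_schwarz l [:: (1, z0)] K0.
rewrite form11 conjC1 !mul1r in D0 CS.
set al := form K l _ in CS.
have -> : form (fun x y => K x y - K x z0 * (K z0 z0)^-1 * K z0 y) l l =
          form K l l - (K z0 z0)^-1 * `|al| ^+ 2.
  have -> : `|al| ^+ 2 = (\sum_(p <- l) p.1 * K p.2 z0) *
                         (\sum_(q <- l) q.1^* * K z0 q.2).
    rewrite normCK /al form_conj // form1r comb_fctE conjC1 mul1r; congr (_ * _).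
    by apply: eq_bigr => q _; rewrite comb1 /= scale1r.
  rewrite /form !pair_comb.
  rewrite mulr_suml mulr_sumr -sumrB; apply: eq_bigr => p _.
  rewrite !mulr_sumr -sumrB; apply: eq_bigr => q _; ring.
rewrite subr_ge0; have [D1|D1] := eqVneq (K z0 z0) 0.
  by rewrite D1 invr0 mul0r.
by rewrite mulrC ler_pdivrMr // lt_def D1.
Qed.

Lemma psd_diag0 K z0 z : psd_kernel K -> K z0 z0 = 0 -> K z0 z = 0.
Proof.
move=> K0 D0; have := form_cauchy_schwarz [:: (1, z0)] [:: (1, z)] K0.
rewrite !form11 conjC1 !mul1r D0 mul0r => h.
apply/eqP; rewrite -normr_eq0 -(sqrf_eq0 `|_|) eq_le h.
by rewrite exprn_ge0.
Qed.

(** Finitely many Schur complements remove the kernel from the rows x i.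
    This replaces an orthonormal basis of the Hilbert space of [K]: at the
    given points [K] is a finite sum of products b y * conj (b z), while the
    remainder stays positive semi-definite on the whole of [Z]. *)
Lemma cholesky K n (x : 'I_n -> Z) : psd_kernel K ->
  exists bs : seq (Z -> C),
    psd_kernel (fun y z => K y z - \sum_(b <- bs) b y * (b z)^*) /\
    forall i z, K (x i) z = \sum_(b <- bs) b (x i) * (b z)^*.
Proof.
move=> K0; suff H m : (m <= n)%N -> exists bs : seq (Z -> C),
    psd_kernel (fun y z => K y z - \sum_(b <- bs) b y * (b z)^*) /\
    forall i : 'I_n, (i < m)%N ->
      forall z, K (x i) z = \sum_(b <- bs) b (x i) * (b z)^*.
  by have [bs [? H1]] := H n (leqnn n); exists bs; split => // i; apply: H1.
elim: m => [_|m IH mn].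
  exists [::]; split => //; rewrite (_ : (fun _ _ => _) = K) //.
  by apply/funext => y; apply/funext => z; rewrite big_nil subr0.
have [bs [L0 Lx]] := IH (ltnW mn); pose z0 := x (Ordinal mn).
set L := (fun y z => _) in L0.
have D0 : 0 <= L z0 z0.
  by have /psd_kernelP/(_ [:: (1, z0)]) := L0; rewrite form11 conjC1 !mul1r.
pose b y := L y z0 / sqrtC (L z0 z0).
have bE y z : b y * (b z)^* = L y z0 * (L z0 z0)^-1 * L z0 z.
  rewrite /b rmorphM /= fmorphV /= [(sqrtC _)^*]geC0_conj ?sqrtC_ge0 // (psd_conj _ _ L0).
  by move: (sqrtCK (L z0 z0)); set r := sqrtC _ => <-; rewrite -exprVn; ring.
exists (b :: bs); split.
  rewrite (_ : (fun _ _ => _) =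
    (fun y z => L y z - L y z0 * (L z0 z0)^-1 * L z0 z)).
    exact: psd_sub_rank1.
  apply/funext => y; apply/funext => z.
  by rewrite big_cons bE /L opprD addrA addrAC.
move=> i im z; rewrite big_cons bE; apply/eqP.
rewrite -subr_eq -/(L (x i) z); apply/eqP.
move: im; rewrite ltnS leq_eqVlt => /predU1P[im|im].
  have -> : i = Ordinal mn by apply: val_inj => /=.
  rewrite -/z0.
  have [E0|E0] := eqVneq (L z0 z0) 0; last by rewrite divff // mul1r.
  by rewrite E0 mul0r mul0r psd_diag0.
have LE z1 : L (x i) z1 = 0 by rewrite /L (Lx i im) subrr.
by rewrite !LE !mul0r.
Qed.

(** The Schur product theorem: on a finite set of points [cholesky] turns the
    second factor into a sum of rank-one kernels, and multiplication by a
    rank-one kernel only rescales the coefficients. *)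
Lemma psd_mul K L : psd_kernel K -> psd_kernel L ->
  psd_kernel (fun x y => K x y * L x y).
Proof.
move=> K0 L0 n x c; have [bs [_ Lx]] := cholesky x L0.
rewrite (_ : \sum_i _ = \sum_(b <- bs) \sum_(i < n) \sum_(j < n)
  (c i * b (x i)) * K (x i) (x j) * (c j * b (x j))^*).
  by apply: sumr_ge0 => b _; apply: (K0 n x (fun i => c i * b (x i))).
rewrite [RHS]exchange_big; apply: eq_bigr => i _ /=.
rewrite [RHS]exchange_big; apply: eq_bigr => j _ /=.
rewrite Lx mulr_sumr mulr_sumr mulr_suml; apply: eq_bigr => b _.
by rewrite rmorphM /=; ring.
Qed.

End Forms.

(** * Almost representing a bounded functional *)

Section Variational.
Variables (R : realType) (Z : Type).
Local Notation C := R[i].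

Lemma conj_add_real (a : C) : a + a^* \is Num.real.
Proof. by apply/CrealP; rewrite rmorphD /= conjCK addrC. Qed.

Lemma conj_add_le (a : C) : a + a^* <= `|a| *+ 2.
Proof.
apply: le_trans (real_ler_norm (conj_add_real a)) _.
by rewrite (le_trans (ler_normD _ _)) // norm_conjC.
Qed.

(** Existence half of the Riesz representation theorem, before any
    completeness is available.  The functional J v = 2 Re f(v) - |v|^2 is
    bounded above since f is bounded; at a v where J is within e of its
    supremum, every perturbation v + t w gains at most e, and optimizing over
    t shows that f - <., v> has norm at most sqrt e. *)
Lemma approx_functional (K : Z -> Z -> C) (f : Z -> C) (c : C) :
    psd_kernel K -> 0 <= c ->
    (forall l, `|pair f l| ^+ 2 <= c * form K l l) ->
  forall e, 0 < e ->
  exists v, forall w, `|pair f w - form K v w| ^+ 2 <= e * form K w w.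
Proof.
move=> K0 c0 fc e e0; have /psd_kernelP Kge0 := K0.
pose Jc v := pair f v + (pair f v)^* - form K v v.
pose J v := complex.Re (Jc v).
have Jreal v : Jc v \is Num.real by rewrite rpredB ?conj_add_real ?ger0_real.
have JE v : (J v)%:C%C = Jc v by rewrite /J RRe_real.
have Re_le (x y : C) : x <= y -> complex.Re x <= complex.Re y.
  by rewrite lecE => /andP[].
pose A := range J.
have supA : has_sup A.
  split; first by exists (J [::]), [::].
  exists (complex.Re c) => _ [v _ <-]; apply: Re_le; rewrite lerBlDr.
  apply: le_trans (conj_add_le _) _; set n := form K v v.
  have n0 : 0 <= n := Kge0 v.
  rewrite -ler_sqr ?nnegrE ?addr_ge0 ?mulrn_wge0 //.
  rewrite -mulr_natl exprMn -subr_ge0.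
  (* (c + n)^2 - 4 |f v|^2 is a square plus 4 (c n - |f v|^2) *)
  rewrite (_ : _ - _ = (c - n) ^+ 2 + 2 ^+ 2 * (c * n - `|pair f v| ^+ 2)).
    apply: addr_ge0; first by rewrite real_exprn_even_ge0 ?rpredB ?ger0_real.
    by rewrite mulr_ge0 ?exprn_ge0 ?subr_ge0.
  ring.
have eR : (complex.Re e)%:C%C = e by rewrite RRe_real ?gtr0_real.
have Re_e : 0 < complex.Re e by rewrite -ltcR eR.
have [_ [v _ <-] vA] := sup_adherent Re_e supA.
exists v => w; apply: quadratic_bound => // [|t]; first exact: ltW.
have : J (v ++ scal t w) <= J v + complex.Re e.
  rewrite -lerBlDr (le_trans _ (ltW vA)) // lerB //.
  by apply: ub_le_sup; [case: supA | exists (v ++ scal t w)].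
rewrite -lecR rmorphD /= !JE eR addrC -lerBlDr; congr (_ <= _).
rewrite /Jc pair_cat pair_scal form_perturb // !(rmorphD, rmorphB, rmorphM) /= conjCK.
ring.
Qed.
End Variational.

(** * Completeness and inner products *)

(** Completeness of the complex numbers, from that of the real and imaginary
    parts, for a function along an arbitrary filter. *)
Lemma complex_cauchy (R : realType) (T : Type) (F : set_system T)
    (FF : ProperFilter F) (g : T -> R[i]) :
    (forall e, 0 < e -> exists2 A, F A &
       forall x y, A x -> A y -> `|g x - g y| <= e) ->
  exists c, forall e, 0 < e -> F [set x | `|g x - c| <= e].
Proof.
move=> Fg.
have part (p : R[i] -> R) : (forall x y : R[i], (`|p x - p y|%:C <= `|x - y|)%C) ->
    exists c : R, forall e : R, 0 < e -> F [set x | `|p (g x) - c| <= e].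
  move=> ple; have : cvg ((p \o g) @ F).
    apply: cauchy_cvg; apply/cauchy_exP => e e0.
    have [|A FA Ag] := Fg (e / 2)%:C%C; first by rewrite ltcR divr_gt0.
    have [x Ax] := filter_ex FA; exists (p (g x)).
    change (F (fun y => ball (p (g x)) e (p (g y)))).
    apply: filterS FA => y Ay; rewrite /ball /=.
    rewrite -ltcR; apply: le_lt_trans (ple _ _) _.
    by rewrite (le_lt_trans (Ag _ _ Ax Ay)) // ltcR ltr_pdivrMr // ltr_pMr // ltr1n.
  move=> /cvg_ex[c gc]; exists c => e e0.
  have /cvgrPdist_le/(_ e e0) := gc; apply: filterS => z.
  by rewrite distrC.
have Re_le (x y : R[i]) : (`|complex.Re x - complex.Re y|)%:C%C <= `|x - y|.
  by rewrite -raddfB normc_ge_Re.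
have Im_le (x y : R[i]) : (`|complex.Im x - complex.Im y|)%:C%C <= `|x - y|.
  rewrite -raddfB -normrN -ReiNIm (le_trans (normc_ge_Re _)) //.
  by rewrite normrM complexiE normCi mulr1.
have [x Fx] := part _ Re_le; have [y Fy] := part _ Im_le.
exists (Complex x y) => e e0.
have eE : (complex.Re e)%:C%C = e by rewrite RRe_real ?gtr0_real.
have e20 : 0 < complex.Re e / 2 by rewrite divr_gt0 // -ltcR eE.
apply: filterS2 (Fx _ e20) (Fy _ e20) => z zx zy /=.
have real_norm (a : R) : `|a%:C%C| = (`|a|)%:C%C.
  by rewrite normc_def /= expr0n /= addr0 sqrtr_sqr.
rewrite [g z - _]complexE -eE (le_trans (ler_normD _ _)) // normrM normCi mul1r.
rewrite !real_norm !raddfB /= -rmorphD lecR.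
by rewrite (le_trans (lerD zx zy)) // -splitr.
Qed.

Section Dot.
Variables (R : realType) (H : hilbertType R).
Local Notation C := R[i].
Implicit Types (u v w : H) (a : C).

Lemma hdotC u v : hdot u v = (hdot v u)^*.
Proof. by rewrite hermC /= expr0 mul1r. Qed.
Lemma hdotDl u v w : hdot (u + v) w = hdot u w + hdot v w.
Proof. by rewrite linearDl. Qed.
Lemma hdotZl a v w : hdot (a *: v) w = a * hdot v w.
Proof. by rewrite linearZl_LR. Qed.
Lemma hdotDr u v w : hdot u (v + w) = hdot u v + hdot u w.
Proof. by rewrite linearDr. Qed.
Lemma hdotZr a v w : hdot v (a *: w) = a^* * hdot v w.
Proof. by rewrite linearZr_LR. Qed.
Lemma hdotNl u v : hdot (- u) v = - hdot u v.
Proof. by rewrite -scaleN1r hdotZl mulN1r. Qed.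
Lemma hdotNr u v : hdot u (- v) = - hdot u v.
Proof. by rewrite hdotC hdotNl rmorphN /= -hdotC. Qed.
Lemma hdotBl u v w : hdot (u - v) w = hdot u w - hdot v w.
Proof. by rewrite hdotDl hdotNl. Qed.
Lemma hdotBr u v w : hdot u (v - w) = hdot u v - hdot u w.
Proof. by rewrite hdotDr hdotNr. Qed.
Lemma hdot0l v : hdot 0 v = 0.
Proof. by rewrite -(scale0r 0) hdotZl mul0r. Qed.
Lemma hdot0r v : hdot v 0 = 0.
Proof. by rewrite hdotC hdot0l conjC0. Qed.

Lemma hdot_eq0 u : hdot u u = 0 -> u = 0.
Proof. by rewrite -hdot_norm => /eqP; rewrite sqrf_eq0 normr_eq0 => /eqP. Qed.

Lemma hdot_inj u v : (forall w, hdot w u = hdot w v) -> u = v.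
Proof. by move=> E; apply/subr0_eq/hdot_eq0; rewrite hdotBr E subrr. Qed.

Variable Z : Type.
Implicit Types (kap : Z -> H) (l : seq (C * Z)).

Definition gram kap x y : C := hdot (kap x) (kap y).

Lemma hdot_combr kap l u : hdot u (comb kap l) = pair (fun z => hdot u (kap z)) l.
Proof.
elim: l => [|[a z] l IH]; first by rewrite comb_nil pair_nil hdot0r.
by rewrite -cat1s comb_cat pair_cat comb1 pair1 hdotDr hdotZr IH.
Qed.

Lemma form_gram kap l l' :
  form (gram kap) l l' = hdot (comb kap l) (comb kap l').
Proof.
rewrite hdot_combr /form; congr (pair _ l'); apply/funext => z.
rewrite comb_fctE hdotC hdot_combr /pair rmorph_sum /=; apply: eq_bigr => p _.
by rewrite rmorphM /= conjCK -hdotC.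
Qed.

Lemma psd_gram kap : psd_kernel (gram kap).
Proof.
by apply/psd_kernelP => l; rewrite form_gram -hdot_norm exprn_ge0.
Qed.

End Dot.

Section DotNorm.
Variables (R : realType) (H : hilbertType R).
Local Notation C := R[i].
Implicit Types (u v w : H) (a : C).

Lemma hdot_cs u v : `|hdot u v| <= `|u| * `|v|.
Proof.
rewrite -ler_sqr ?nnegrE ?mulr_ge0 // exprMn !hdot_norm.
have := form_cauchy_schwarz [:: (1, u)] [:: (1, v)] (psd_gram (fun x : H => x)).
by rewrite !form_gram !comb1 !scale1r.
Qed.

(** The bounds [e] survive in the limit, which gives a rate of convergence. *)
Lemma hilbert_limit (u : nat -> H) (e : nat -> C) :
    (forall d, 0 < d -> exists N, forall n, (N <= n)%N -> e n <= d) ->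
    (forall n m, `|u n - u m| <= e n + e m) ->
  exists l, forall n, `|u n - l| <= e n.
Proof.
move=> e0 ue; have : cvg (u @ \oo).
  apply: cauchy_cvg; apply/cauchy_exP => d d0.
  have [|N eN] := e0 (d / 3); first by rewrite divr_gt0.
  exists (u N); exists N => // n /= Nn; rewrite -ball_normE /=.
  apply: le_lt_trans (ue _ _) _.
  apply: le_lt_trans (lerD (eN _ (leqnn N)) (eN _ Nn)) _.
  rewrite -subr_gt0 (_ : _ - _ = d / 3); last by field.
  by rewrite divr_gt0.
move=> /cvg_ex[l ul]; exists l => n; apply/ler_addgt0Pr => d d0.
have [|N eN] := e0 (d / 2); first by rewrite divr_gt0.
have /cvgrPdist_le/(_ (d / 2)) := ul; rewrite divr_gt0 // => /(_ isT)[N' _ uN].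
pose m := maxn N N'.
rewrite -(subrK (u m) (u n)) -addrA (le_trans (ler_normD _ _)) //.
rewrite [d]splitr addrA lerD //; last by rewrite distrC uN //= leq_maxr.
by rewrite (le_trans (ue _ m)) // lerD2l eN // leq_maxl.
Qed.

Lemma closureP_norm (A : set H) u :
  closure A u <-> forall e, 0 < e -> exists2 v, A v & `|u - v| <= e.
Proof.
split=> [Au e e0|Au].
  have /Au[v [Av uv]] : nbhs u (ball u e) by exact: nbhsx_ballx.
  by exists v => //; move: uv; rewrite -ball_normE => /ltW.
move=> B /nbhs_ballP[e /= e0 uB]; have [|v Av uv] := Au (e / 2).
  by rewrite divr_gt0.
exists v; split=> //; apply: uB; rewrite -ball_normE /=.
by rewrite (le_lt_trans uv) // ltr_pdivrMr // ltr_pMr // ltr1n.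
Qed.

Lemma bounded_continuous (G : hilbertType R) (A : H -> G) (c : C) :
  0 <= c -> linear A -> (forall u, `|A u| <= c * `|u|) -> continuous A.
Proof.
move=> c0 linA Ac u; apply/cvgrPdist_le => e e0.
have c10 : 0 < c + 1 by rewrite ltr_wpDl.
near=> v; have -> : A u - A v = A (u - v).
  by rewrite addrC -scaleN1r -linA scaleN1r addrC.
rewrite (le_trans (Ac _)) //.
have : `|u - v| <= e / (c + 1).
  near: v; apply: cvgr_dist_le; last by rewrite divr_gt0.
  exact: cvg_id.
rewrite ler_pdivlMr // mulrC; apply: le_trans.
by rewrite ler_wpM2r // lerDl.
Unshelve. all: by end_near. Qed.

Lemma continuous_bounded (G : hilbertType R) (A : {linear H -> G}) :
  continuous A -> exists2 c : C, 0 < c & forall u, `|A u| <= c * `|u|.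
Proof.
move=> /linear_bounded_continuous/linear_boundedP; case=> c [cr Ac].
have c1 : c < `|c| + 1 by rewrite (le_lt_trans (real_ler_norm cr)) // ltrDl.
by exists (`|c| + 1); [rewrite ltr_wpDl | exact: Ac].
Qed.

(** Used to bound a norm through its square, itself estimated by the
    Cauchy-Schwarz inequality. *)
Lemma norm_le_dot u (c : C) : `|u| ^+ 2 <= c * `|u| -> 0 <= c -> `|u| <= c.
Proof.
have [->|u0] := eqVneq u 0; first by rewrite normr0.
by rewrite expr2 ler_pM2r // normr_gt0.
Qed.

End DotNorm.

(** * The Riesz representation theorem for families of vectors *)

Section Riesz.
Variable R : realType.
Local Notation C := R[i].

Lemma small_eq0 (V : normedZmodType C) (x : V) :
  (forall d, 0 < d -> `|x| <= d) -> x = 0.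
Proof.
move=> xd; apply/eqP; rewrite -normr_le0; apply/ler_addgt0Pr => d d0.
by rewrite add0r xd.
Qed.

(** Estimates that depend on an approximation within d come with a factor;
    the restriction to d <= 1 absorbs quadratic terms in d. *)
Lemma le_small_mul (x y c : C) : 0 <= c ->
  (forall d, 0 < d -> d <= 1 -> x <= y + c * d) -> x <= y.
Proof.
move=> c0 xc; apply/ler_addgt0Pr => d d0.
have c1 : 0 < c + 1 + d by rewrite !ltr_wpDl // addr_ge0.
apply: le_trans (xc (d / (c + 1 + d)) _ _) _; first by rewrite divr_gt0.
  by rewrite ler_pdivrMr // mul1r lerDr addr_ge0.
rewrite lerD2l mulrCA ger_pMr // ler_pdivrMr // mul1r -addrA lerDl.
by rewrite addr_ge0 // ltW.
Qed.

Lemma small_mul_eq0 (V : normedZmodType C) (x : V) (c : C) : 0 <= c ->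
  (forall d, 0 < d -> d <= 1 -> `|x| <= c * d) -> x = 0.
Proof.
move=> c0 xc; apply/eqP; rewrite -normr_le0; apply: (le_small_mul c0) => d d0 d1.
by rewrite add0r xc.
Qed.

Lemma harmonic_small (d : C) : 0 < d ->
  exists N, forall n, (N <= n)%N -> n.+1%:R^-1 <= d.
Proof.
move=> d0; have dE : (complex.Re d)%:C%C = d by rewrite RRe_real ?gtr0_real.
have Re0 : 0 < complex.Re d by rewrite -ltcR dE.
exists (Num.truncn (complex.Re d)^-1) => n Nn.
rewrite -[leRHS]invrK lef_pV2 ?posrE ?invr_gt0 ?ltr0Sn //.
rewrite -dE -(rmorph_nat (real_complex R)) -fmorphV lecR.
apply: ltW; apply: lt_le_trans (truncnS_gt _) _.
by rewrite ler_nat ltnS.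
Qed.

Variable H : hilbertType R.

(** A function on the index set that is bounded with respect to the norm of
    the combinations of [kap] is represented by a vector of the closed span.
    Approximate representatives with error 1/(n+1) exist by
    [approx_functional]; two of them differ by a combination of [kap], so
    testing that difference on itself shows that they form a Cauchy sequence.
    Adjoints, projections, evaluation maps and multiplication operators are
    all obtained below as instances, by choosing the family. *)
Theorem riesz_family (Z : Type) (kap : Z -> H) (f : Z -> C) (c : C) :
    0 <= c -> (forall l, `|pair f l| <= c * `|comb kap l|) ->
  exists g, [/\ closure (range (comb kap)) g,
                forall z, hdot g (kap z) = f z & `|g| <= c].
Proof.
move=> c0 fc; pose e n : C := n.+1%:R^-1.
have e_gt0 n : 0 < e n by rewrite invr_gt0.
have fc2 l : `|pair f l| ^+ 2 <= c ^+ 2 * form (gram kap) l l.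
  by rewrite form_gram -hdot_norm -exprMn lerXn2r ?nnegrE ?mulr_ge0.
have approx n : {v | forall w,
    `|pair f w - hdot (comb kap v) (comb kap w)| <= e n * `|comb kap w|}.
  apply: cid; have [||v vP] := approx_functional (psd_gram kap) _ fc2 (e := e n ^+ 2).
  - by rewrite exprn_ge0.
  - by rewrite exprn_gt0.
  exists v => w; rewrite -ler_sqr ?nnegrE ?mulr_ge0 ?(ltW (e_gt0 n)) //.
  by rewrite exprMn hdot_norm -!form_gram.
pose v n := sval (approx n); pose h n := comb kap (v n).
have hP n w : `|pair f w - hdot (h n) (comb kap w)| <= e n * `|comb kap w|.
  exact: (svalP (approx n)).
have [||g hg] := @hilbert_limit _ H h e; first exact: harmonic_small.
  move=> n m; apply: norm_le_dot; last by rewrite addr_ge0 // ltW.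
  have wE : h n - h m = comb kap (v n ++ scal (-1) (v m)).
    by rewrite comb_cat comb_scal scaleN1r.
  rewrite hdot_norm hdotBl -[X in X <= _]ger0_norm; last first.
    by rewrite -hdotBl -hdot_norm exprn_ge0.
  (* both approximate the functional at the combination h n - h m itself *)
  rewrite wE mulrDl; set w := _ ++ _.
  rewrite -(subrKA (pair f w)) (le_trans (ler_normD _ _)) // lerD //.
  by rewrite distrC.
exists g; split=> [|z|].
- apply/closureP_norm => d d0; have [N Nd] := harmonic_small d0.
  exists (h N); first by exists (v N).
  by rewrite distrC (le_trans (hg N)) // Nd.
- apply/esym/subr0_eq/small_eq0 => d d0.
  have k0 : 0 < 1 + `|kap z| by rewrite ltr_pwDl.
  have [|N Nd] := @harmonic_small (d / 2 / (1 + `|kap z|)).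
    by rewrite !divr_gt0.
  have {}Nd : e N * `|kap z| <= d / 2.
    have := Nd N (leqnn N); rewrite ler_pdivlMr //; apply: le_trans.
    by rewrite ler_pM2l // lerDr.
  rewrite -(subrKA (hdot (h N) (kap z))) [d]splitr.
  rewrite (le_trans (ler_normD _ _)) // lerD //.
    have := hP N [:: (1, z)]; rewrite pair1 comb1 scale1r conjC1 mul1r => /le_trans.
    exact.
  rewrite -hdotBl (le_trans (hdot_cs _ _)) // (le_trans _ Nd) //.
  by rewrite ler_wpM2r.
- apply/ler_addgt0Pr => d d0.
  have [|N Nd] := @harmonic_small (d / 2); first by rewrite divr_gt0.
  have {}Nd : e N <= d / 2 := Nd N (leqnn N).
  rewrite -(subrK (h N) g) (le_trans (ler_normD _ _)) // addrC [d]splitr addrA.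
  rewrite lerD //; last by rewrite distrC (le_trans (hg N)).
  have : `|h N| <= c + e N.
    apply: norm_le_dot; last by rewrite addr_ge0 // ltW.
    rewrite hdot_norm mulrDl -[X in X <= _]ger0_norm; last first.
      by rewrite -hdot_norm exprn_ge0.
    rewrite -[hdot _ _](subrK (pair f (v N))) (le_trans (ler_normD _ _)) //.
    by rewrite addrC lerD ?fc // distrC.
  by move=> /le_trans; apply; rewrite lerD2l.
Qed.

(** Riesz representation for the family of all vectors of [M]. *)
Lemma orthogonal_projection (M : set H) u : closed_subspace M ->
  exists2 p, M p & forall m, M m -> hdot p m = hdot u m.
Proof.
move=> [Mcl M0 Mlin]; pose kap (z : {m | M m}) := sval z.
have [||g [gcl gE _]] := @riesz_family _ kap (fun z => hdot u (kap z)) `|u|.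
- by [].
- by move=> l; rewrite -hdot_combr hdot_cs.
exists g; last by move=> m Mm; apply: (gE (exist _ m Mm)).
rewrite ((closure_id M).1 Mcl); apply: closureS gcl => _ [l _ <-].
elim: l => [|[a z] l IH]; first by rewrite comb_nil.
by rewrite -cat1s comb_cat comb1; apply: Mlin => //; exact: (svalP z).
Qed.

End Riesz.

(** * The Hilbert space of a positive semi-definite kernel *)

Section KernelNorm.
Variables (R : realType) (Z : Type) (K : Z -> Z -> R[i]).
Local Notation C := R[i].
Implicit Types (f g : Z -> C) (c : C).

(** A bound for f as a functional on the span of the kernel functions with
    the seminorm of [form K]; such functions form the Hilbert space of [K]. *)
Definition kbound f c := 0 <= c /\
  forall l, `|pair f l| <= c * sqrtC (form K l l).

Definition kbounded : {pred Z -> C} := fun f => `[< exists c, kbound f c >].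

(** Least bound of f; the infimum is taken over the reals and is attained. *)
Definition knorm f : C :=
  ((inf [set r : R | kbound f (r%:C)%C])%:C)%C.

Lemma kbounded_submod : submod_closed kbounded.
Proof.
split=> [|a f g /asboolP[c [c0 fc]] /asboolP[d [d0 gd]]]; apply/asboolP.
  exists 0; split=> // l; rewrite mul0r -(scale0r (0 : Z -> C)) pairZ mul0r.
  by rewrite normr0.
exists (`|a| * c + d); split=> [|l]; first by rewrite addr_ge0 ?mulr_ge0.
rewrite pairD pairZ (le_trans (ler_normD _ _)) // normrM mulrDl lerD //.
by rewrite -mulrA ler_wpM2l.
Qed.

Hypothesis K0 : psd_kernel K.

Lemma sqrtC_form_ge0 l : 0 <= sqrtC (form K l l).
Proof. by rewrite sqrtC_ge0; move/psd_kernelP: K0. Qed.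

Lemma knorm_ge0 f : 0 <= knorm f.
Proof.
rewrite /knorm ler0c; have [->|S0] := eqVneq [set r : R | kbound f (r%:C)%C] set0.
  by rewrite inf0.
by apply: lb_le_inf; [exact/set0P | move=> r [/=]; rewrite ler0c].
Qed.

Lemma knorm_le f c : kbound f c -> knorm f <= c.
Proof.
move=> fc; have cE : (complex.Re c)%:C%C = c.
  by rewrite RRe_real // ger0_real //; case: fc.
rewrite -cE /knorm lecR; apply: ge_inf => /=; last by rewrite cE.
by exists 0 => r [/=]; rewrite ler0c.
Qed.

Lemma knormP f l : f \in kbounded ->
  `|pair f l| <= knorm f * sqrtC (form K l l).
Proof.
move=> /asboolP[c fc].
have [F0|F0] := eqVneq (sqrtC (form K l l)) 0.
  by have [_ /(_ l)] := fc; rewrite F0 !mulr0.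
have F1 : 0 < sqrtC (form K l l) by rewrite lt_def F0 sqrtC_form_ge0.
rewrite -ler_pdivrMr //; set q := _ / _.
have qE : (complex.Re q)%:C%C = q.
  by rewrite RRe_real // ger0_real // divr_ge0 // ltW.
have cE : (complex.Re c)%:C%C = c.
  by rewrite RRe_real // ger0_real //; case: fc.
rewrite -qE /knorm lecR; apply: lb_le_inf.
  by exists (complex.Re c); rewrite /= cE.
by move=> r [/= r0 /(_ l)]; rewrite -lecR qE ler_pdivrMr.
Qed.

Lemma knormD f g : f \in kbounded -> g \in kbounded ->
  knorm (f + g) <= knorm f + knorm g.
Proof.
move=> fb gb; apply: knorm_le; split=> [|l]; first by rewrite addr_ge0 ?knorm_ge0.
by rewrite pairD (le_trans (ler_normD _ _)) // mulrDl lerD ?knormP.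
Qed.

Lemma knormZ a f : f \in kbounded -> knorm (a *: f) = `|a| * knorm f.
Proof.
move=> fb; have le b g : g \in kbounded -> knorm (b *: g) <= `|b| * knorm g.
  move=> gb; apply: knorm_le; split=> [|l]; first by rewrite mulr_ge0 ?knorm_ge0.
  by rewrite pairZ normrM -mulrA ler_wpM2l ?knormP.
have Zb b g : g \in kbounded -> b *: g \in kbounded.
  move=> gb; rewrite -[b *: g]addr0; apply: kbounded_submod.2 => //.
  exact: kbounded_submod.1.
apply/eqP; rewrite eq_le le //=; have [->|a0] := eqVneq a 0.
  by rewrite normr0 mul0r knorm_ge0.
have := le a^-1 _ (Zb a f fb); rewrite scalerA mulVf // scale1r normfV.
by rewrite ler_pdivlMl // normr_gt0.
Qed.

Lemma knorm_eq0 f : f \in kbounded -> knorm f = 0 -> f = 0.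
Proof.
move=> fb f0; apply/funext => z; have := knormP [:: (1, z)] fb.
by rewrite f0 mul0r normr_le0 pair1 conjC1 mul1r => /eqP.
Qed.

Lemma kbounded_comb l : comb (K : Z -> (Z -> C)) l \in kbounded.
Proof.
apply/asboolP; exists (sqrtC (form K l l)); split=> [|w].
  exact: sqrtC_form_ge0.
have /psd_kernelP Kge0 := K0.
rewrite -ler_sqr ?nnegrE ?mulr_ge0 ?sqrtC_form_ge0 // exprMn !sqrtCK.
exact: form_cauchy_schwarz.
Qed.

End KernelNorm.

(** The Hilbert space with kernel [K], as the space of all functions that are
    bounded functionals on the span of the kernel functions.  Taking the dual
    from the start makes completeness elementary, and no quotient or
    completion is needed. *)
Record kspace (R : realType) (Z : Type) (K : Z -> Z -> R[i])
  (K0 : psd_kernel K) := KSpace { kfun : Z -> R[i]; kfunP : kfun \in kbounded K }.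

Section KSpace.
Variables (R : realType) (Z : Type) (K : Z -> Z -> R[i]) (K0 : psd_kernel K).
Local Notation C := R[i].

HB.instance Definition _ := [isSub for @kfun R Z K K0].
HB.instance Definition _ := [Choice of kspace K0 by <:].
HB.instance Definition _ :=
  GRing.isSubmodClosed.Build C (Z -> C) (kbounded K) (kbounded_submod K).
HB.instance Definition _ := [SubChoice_isSubLmodule of kspace K0 by <:].

Definition kspace_norm (f : kspace K0) := knorm K (kfun f).
Lemma kspace_normD f g : kspace_norm (f + g) <= kspace_norm f + kspace_norm g.
Proof. by apply: knormD => //; apply: kfunP. Qed.
Lemma kspace_normZ a f : kspace_norm (a *: f) = `|a| * kspace_norm f.
Proof. by apply: knormZ => //; apply: kfunP. Qed.
Lemma kspace_norm_eq0 f : kspace_norm f = 0 -> f = 0.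
Proof. by move=> f0; apply/val_inj/(knorm_eq0 K0 _ f0); exact: kfunP. Qed.

HB.instance Definition _ := Lmodule_isNormed.Build C (kspace K0)
  kspace_normD kspace_normZ kspace_norm_eq0.

End KSpace.

Section KSpaceComplete.
Variables (R : realType) (Z : Type) (K : Z -> Z -> R[i]) (K0 : psd_kernel K).
Local Notation C := R[i].
Local Notation H := (kspace K0).
Implicit Types (f g h : H) (l w : seq (C * Z)).

Lemma kfunD f g : kfun (f + g) = kfun f + kfun g. Proof. by []. Qed.
Lemma kfunZ (a : C) f : kfun (a *: f) = a *: kfun f. Proof. by []. Qed.
Lemma kfunB f g : kfun (f - g) = kfun f - kfun g. Proof. by []. Qed.
Lemma knormE f : `|f| = knorm K (kfun f). Proof. by []. Qed.

Lemma kernel_kbounded z : K z \in kbounded K.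
Proof. by have := kbounded_comb K0 [:: (1, z)]; rewrite comb1 scale1r. Qed.

Definition kspace_kernel (z : Z) : H := KSpace K0 (kernel_kbounded z).
Local Notation kap := kspace_kernel.

Lemma kfun_comb l : kfun (comb kap l) = comb (K : Z -> (Z -> C)) l.
Proof.
elim: l => [|[a z] l IH]; first by rewrite !comb_nil.
by rewrite -cat1s !comb_cat kfunD IH !comb1.
Qed.

Lemma norm_comb l : `|comb kap l| = sqrtC (form K l l).
Proof.
have N0 := sqrtC_form_ge0 K0 l; rewrite knormE kfun_comb.
apply/eqP; rewrite eq_le knorm_le ?andbT //; last first.
  split=> // w; rewrite -ler_sqr ?nnegrE ?mulr_ge0 ?sqrtC_form_ge0 //.
  by rewrite exprMn !sqrtCK form_cauchy_schwarz.
have := knormP K0 l (kbounded_comb K0 l); rewrite -/(form K l l) ger0_norm; last first.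
  by move/psd_kernelP: K0.
rewrite -{1}(sqrtCK (form K l l)).
have [-> _|F0] := eqVneq (sqrtC (form K l l)) 0; first exact: knorm_ge0.
by rewrite expr2 ler_pM2r // lt_def F0.
Qed.

Lemma pair_le f l : `|pair (kfun f) l| <= `|f| * `|comb kap l|.
Proof. by rewrite norm_comb; apply/knormP/kfunP. Qed.

Lemma norm_le f (c : C) : 0 <= c ->
  (forall l, `|pair (kfun f) l| <= c * `|comb kap l|) -> `|f| <= c.
Proof.
by move=> c0 fc; apply: knorm_le => //; split=> // l; rewrite -norm_comb.
Qed.

(** By [approx_functional], the dual contains nothing but limits of kernel
    functions. *)
Lemma comb_dense f (e : C) : 0 < e -> exists l, `|f - comb kap l| <= e.
Proof.
move=> e0; have /psd_kernelP Kge0 := K0.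
have f0 : 0 <= `|f| ^+ 2 by rewrite exprn_ge0.
have fw w : `|pair (kfun f) w| ^+ 2 <= `|f| ^+ 2 * form K w w.
  rewrite -[form K w w]sqrtCK -exprMn -norm_comb.
  by rewrite lerXn2r ?nnegrE ?mulr_ge0 ?pair_le.
have [l lP] := approx_functional K0 f0 fw (exprn_gt0 2 e0).
exists l; apply: norm_le => [|w]; first exact: ltW.
rewrite -ler_sqr ?nnegrE ?mulr_ge0 ?(ltW e0) // exprMn norm_comb sqrtCK.
by rewrite kfunB kfun_comb pairB.
Qed.

(** A Cauchy filter converges pointwise; closeness in norm is a family of
    inequalities between values on finite combinations, which pass to the
    pointwise limit. *)
Lemma kspace_complete (F : set_system H) : ProperFilter F -> cauchy F -> cvg F.
Proof.
move=> FF /cauchy_ballP Fc.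
have {}Fc (e : C) : 0 < e -> exists2 A, F A &
    forall h h', A h -> A h' -> `|h - h'| <= e.
  move=> e0; have [[A B] /= [FA FB] AB] := Fc e e0.
  exists (A `&` B); first exact: filterI.
  move=> h h' [Ah _] [_ Bh']; apply: ltW.
  have := AB (h, h'); rewrite /= -ball_normE => hh; exact: hh.
have [f fP] : exists f : Z -> C, forall z e, 0 < e ->
    F [set h | `|kfun h z - f z| <= e].
  suff /choice : forall z, exists c, forall e, 0 < e ->
      F [set h | `|kfun h z - c| <= e] by move=> [f fP]; exists f.
  move=> z; apply: complex_cauchy => e e0.
  have k0 : 0 < 1 + `|kap z| by rewrite ltr_pwDl.
  have [|A FA AP] := Fc (e / (1 + `|kap z|)); first by rewrite divr_gt0.
  exists A => // h h' Ah Ah'; have := pair_le (h - h') [:: (1, z)].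
  rewrite pair1 comb1 scale1r conjC1 mul1r kfunB => /le_trans; apply.
  apply: le_trans (_ : _ <= e / (1 + `|kap z|) * (1 + `|kap z|)) _.
    by apply: ler_pM; rewrite ?lerDr //; apply: AP.
  by rewrite divfK ?gt_eqF.
have {}fP l e : 0 < e -> F [set h | `|pair (kfun h - f) l| <= e].
  elim: l e => [|[a z] l IH] e e0.
    by apply: filterS filterT => h _ /=; rewrite pair_nil normr0 ltW.
  have a0 : 0 < `|a| + 1 by rewrite ltr_wpDl.
  apply: filterS2 (fP z (e / 2 / (`|a| + 1)) _) (IH (e / 2) _) => [h hz hl /=||].
  - rewrite -cat1s pair_cat pair1 (le_trans (ler_normD _ _)) // [e]splitr lerD //.
    rewrite normrM norm_conjC; apply: le_trans (ler_wpM2l _ hz) _ => //.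
    rewrite mulrCA ler_piMr ?divr_ge0 ?ltW //.
    by rewrite ltr_pdivrMr // mul1r ltrDl.
  - by rewrite !divr_gt0.
  - by rewrite divr_gt0.
have near e : 0 < e -> exists2 A, F A & forall h, A h -> kbound K (kfun h - f) e.
  move=> e0; have [A FA AP] := Fc e e0; exists A => // h Ah; split=> [|l].
    exact: ltW.
  apply/ler_addgt0Pr => d d0.
  have [h' [Ah' h'l]] := filter_ex (filterI FA (fP l d d0)).
  rewrite -(subrKA (kfun h')) pairD (le_trans (ler_normD _ _)) // lerD //.
  rewrite -norm_comb -kfunB (le_trans (pair_le _ _)) // ler_wpM2r //.
  exact: AP.
have fb : f \in kbounded K.
  have [A FA AP] := near 1 ltr01; have [h /AP hf] := filter_ex FA.
  rewrite -[f](subKr (kfun h)); apply: rpredB; first exact: kfunP.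
  by apply/asboolP; exists 1.
apply/cvg_ex; exists (KSpace K0 fb); apply/cvgrPdist_le => e e0.
have [A FA AP] := near e e0; apply: filterS FA => h /AP hf.
by rewrite distrC knormE kfunB; apply: knorm_le.
Qed.

HB.instance Definition _ := Uniform_isComplete.Build H kspace_complete.
End KSpaceComplete.

Section KSpaceDot.
Variables (R : realType) (Z : Type) (K : Z -> Z -> R[i]) (K0 : psd_kernel K).
Local Notation C := R[i].
Local Notation H := (kspace K0).
Local Notation kap := (kspace_kernel K0).
Implicit Types (f g h : H) (l w : seq (C * Z)).

(** The inner product of f and g is the limit of the values of f along
    combinations of kernel functions that converge to g.  The estimate also
    characterizes it, see [kdot_unique], and this makes linearity in f
    immediate. *)
Lemma kspace_dot_exists f g : exists c, forall l,
  `|pair (kfun f) l - c| <= `|f| * `|g - comb kap l|.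
Proof.
pose near_g (d : C) := [set l | `|g - comb kap l| <= d].
pose F := filter_from [set d : C | 0 < d] near_g.
have FF : ProperFilter F.
  apply: filter_from_proper; last first.
    by move=> d d0; have [l gl] := comb_dense g d0; exists l.
  apply: filter_from_filter; first by exists 1; rewrite /= ltr01.
  move=> d d' d0 d'0; rewrite /= in d0 d'0.
  have [le|le] : d <= d' \/ d' <= d.
      by apply/orP; rewrite real_leVge ?gtr0_real.
    by exists d => // l gl; split=> //; apply: le_trans gl le.
  by exists d' => // l gl; split=> //; apply: le_trans gl le.
have pairE (l l' : seq (C * Z)) :
    `|pair (kfun f) l - pair (kfun f) l'| <= `|f| * `|comb kap l - comb kap l'|.
  have := pair_le f (l ++ scal (-1) l').
  by rewrite pair_cat pair_scal rmorphN1 mulN1r comb_cat comb_scal scaleN1r.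
have f0 : 0 < `|f| + 1 by rewrite ltr_wpDl.
have [|c cP] := @complex_cauchy R _ F FF (pair (kfun f)).
  move=> e e0; exists (near_g (e / 2 / (`|f| + 1))).
    by exists (e / 2 / (`|f| + 1)); rewrite //= !divr_gt0.
  move=> l l' gl gl'; apply: le_trans (pairE l l') _.
  apply: le_trans (_ : (`|f| + 1) * (e / 2 / (`|f| + 1) *+ 2) <= _); last first.
    by rewrite (_ : (`|f| + 1) * _ = e) //; field; rewrite gt_eqF.
  rewrite ler_pM ?lerDl // -(subrKA g) mulr2n (le_trans (ler_normD _ _)) //.
  by rewrite lerD // distrC.
exists c => l; apply/ler_addgt0Pr => d d0.
pose d' := d / (`|f| + 1).
have d'0 : 0 < d' by rewrite divr_gt0.
have Fd : F (near_g d') by exists d'.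
have [l' [/= l'c gl']] := filter_ex (filterI (cP d' d'0) Fd).
rewrite -(subrKA (pair (kfun f) l')) (le_trans (ler_normD _ _)) //.
apply: le_trans (lerD (pairE _ _) l'c) _.
apply: le_trans (_ : `|f| * (`|g - comb kap l| + d') + d' <= _); last first.
  have dE : d = (`|f| + 1) * d' by rewrite /d' mulrC divfK ?gt_eqF.
  by rewrite [in leRHS]dE le_eqVlt; apply/orP; left; apply/eqP; ring.
rewrite lerD2r ler_wpM2l // -(subrKA g) (le_trans (ler_normD _ _)) //.
by rewrite lerD // distrC.
Qed.

Definition kdot f g : C := sval (cid (kspace_dot_exists f g)).

Lemma kdotP f g l : `|pair (kfun f) l - kdot f g| <= `|f| * `|g - comb kap l|.
Proof. exact: (svalP (cid (kspace_dot_exists f g))). Qed.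

Lemma kdot_unique f g (x c : C) : 0 <= c ->
  (forall l, `|pair (kfun f) l - x| <= c * `|g - comb kap l|) -> x = kdot f g.
Proof.
move=> c0 xc; apply/subr0_eq/(@small_mul_eq0 _ _ _ (c + `|f|)).
  by rewrite addr_ge0.
move=> d d0 _; have [l gl] := comb_dense g d0.
rewrite -(subrKA (pair (kfun f) l)) (le_trans (ler_normD _ _)) // mulrDl lerD //.
  by rewrite distrC (le_trans (xc l)) // ler_wpM2l.
by rewrite (le_trans (kdotP f g l)) // ler_wpM2l.
Qed.

Lemma kdot_comb f l : kdot f (comb kap l) = pair (kfun f) l.
Proof.
have := kdotP f (comb kap l) l.
by rewrite subrr normr0 mulr0 normr_le0 subr_eq0 => /eqP.
Qed.

Lemma kdot_le f g : `|kdot f g| <= `|f| * `|g|.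
Proof.
have := kdotP f g [::].
by rewrite pair_nil sub0r normrN comb_nil subr0.
Qed.

Lemma kdot_linearl g : scalar (kdot^~ g).
Proof.
move=> a f f'; apply/esym/(@kdot_unique _ _ _ (`|a| * `|f| + `|f'|)).
  by rewrite addr_ge0 ?mulr_ge0.
move=> l; rewrite kfunD kfunZ pairD pairZ opprD addrACA -mulrBr.
rewrite (le_trans (ler_normD _ _)) // normrM mulrDl -mulrA.
by rewrite lerD ?ler_wpM2l ?kdotP.
Qed.

(** Symmetry holds for kernel functions because [K] is hermitian, then for one
    arbitrary argument and finally for both, by density. *)
Lemma kdot_conj f g : kdot f g = (kdot g f)^*.
Proof.
have combE w : (kdot (comb kap w) f)^* = kdot f (comb kap w).
  rewrite kdot_comb; apply/subr0_eq/(@small_mul_eq0 _ _ _ (`|comb kap w| *+ 2)).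
    by rewrite mulrn_wge0.
  move=> d d0 _; have [l fl] := comb_dense f d0.
  rewrite -(subrKA (form K l w)) (le_trans (ler_normD _ _)) // mulr2n mulrDl lerD //.
    rewrite -(form_conj _ _ K0) -rmorphB norm_conjC distrC /form -kfun_comb.
    by rewrite (le_trans (kdotP _ _ _)) // ler_wpM2l.
  rewrite distrC /form -kfun_comb -pairB -kfunB (le_trans (pair_le _ _)) //.
  by rewrite mulrC ler_wpM2l.
apply/esym/(@kdot_unique _ _ _ `|f|) => // l.
rewrite -kdot_comb -combE -rmorphB norm_conjC.
have -> : kdot (comb kap l) f - kdot g f = kdot (comb kap l - g) f.
  by rewrite addrC -mulN1r -kdot_linearl scaleN1r addrC.
by rewrite (le_trans (kdot_le _ _)) // mulrC distrC.
Qed.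

(** The identity is exact for combinations c of kernel functions; the three
    error terms are bounded by |f - c| times the norms of f and c. *)
Lemma kdot_norm f : `|f| ^+ 2 = kdot f f.
Proof.
apply/subr0_eq/(@small_mul_eq0 _ _ _ ((`|f| + (`|f| + 1)) *+ 2)).
  by rewrite mulrn_wge0 ?addr_ge0.
move=> d d0 d1; have [l fl] := comb_dense f d0; set c := comb kap l in fl.
have cf : `|c| <= `|f| + 1.
  rewrite -(subrK f c) addrC (le_trans (ler_normD _ _)) // lerD2l distrC.
  exact: le_trans d1.
have cc : kdot c c = `|c| ^+ 2.
  by rewrite /c kdot_comb kfun_comb norm_comb sqrtCK.
have kB g h k : kdot g k - kdot h k = kdot (g - h) k.
  by rewrite addrC -mulN1r -kdot_linearl scaleN1r addrC.
have -> : `|f| ^+ 2 - kdot f f = (`|f| ^+ 2 - `|c| ^+ 2)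
    - (kdot f f - kdot c f) - (kdot c f - kdot c c) by rewrite cc; ring.
rewrite (kB f c f) [kdot c f]kdot_conj [kdot c c]kdot_conj -rmorphB (kB f c c).
have c0 : 0 <= `|c| by [].
rewrite -addrA -opprD (le_trans (ler_normB _ _)) // mulr2n mulrDl lerD //.
  rewrite subr_sqr normrM mulrC ler_pM //.
    by rewrite ger0_norm ?addr_ge0 // lerD2l.
  by apply: le_trans fl; rewrite ler_dist_dist.
rewrite (le_trans (ler_normD _ _)) // mulrDl lerD //.
  by rewrite (le_trans (kdot_le _ _)) // mulrC ler_wpM2l.
rewrite norm_conjC (le_trans (kdot_le _ _)) // mulrC ler_pM //.
Qed.

Lemma kdot_linearr f : linear_for (@Num.conj C \; *%R) (kdot f).
Proof.
move=> a g g'; rewrite ![kdot f _]kdot_conj kdot_linearl.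
by rewrite rmorphD rmorphM.
Qed.

Lemma kdot_gt0 f : f != 0 -> 0 < kdot f f.
Proof. by move=> f0; rewrite -kdot_norm exprn_gt0 ?normr_gt0. Qed.

HB.instance Definition _ := bilinear_isBilinear.Build C H H C *%R (@Num.conj C \; *%R)
  kdot (kdot_linearl, kdot_linearr).
HB.instance Definition _ := isHermitianSesquilinear.Build C H false (@Num.conj C) kdot
  (fun f g => etrans (kdot_conj f g) (esym (mul1r _))).
HB.instance Definition _ := isDotProduct.Build C H kdot kdot_gt0.
HB.instance Definition _ := isHilbert.Build R H kdot_norm.

End KSpaceDot.

(** Realized in [kspace K0], where the inner product of two kernel functions
    is a value of [K] because pairing with a kernel function is evaluation. *)
Theorem kolmogorov (R : realType) (Z : Type) (K : Z -> Z -> R[i]) :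
  psd_kernel K -> exists (H : hilbertType R) (kap : Z -> H),
    (forall x y, hdot (kap x) (kap y) = K x y) /\
    forall u, closure (range (comb kap)) u.
Proof.
move=> K0; exists (kspace K0), (kspace_kernel K0); split=> [x y|u].
  change (kdot (kspace_kernel K0 x) (kspace_kernel K0 y) = K x y).
  have := kdot_comb (kspace_kernel K0 x) [:: (1, y)].
  by rewrite comb1 scale1r pair1 conjC1 mul1r => ->.
apply/closureP_norm => e e0; have [l ul] := comb_dense u e0.
by exists (comb (kspace_kernel K0) l) => //; exists l.
Qed.

(** * Uniform boundedness *)

Section UniformBoundedness.
Variables (R : realType) (H : hilbertType R).
Local Notation C := R[i].

(** Gliding hump.  If S contains vectors w n with |w n| > n 3^n, walk by steps
    of length 3^-n along w n, in the direction that makes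
    |<x (n+1), w n>| >= 3^-n |w n|.  All later steps have total length at most
    half of 3^-n, so that the limit z has |<z, w n>| > n / 2. *)
Lemma uniform_boundedness (S : set H) :
  (forall u, exists c, forall w, S w -> `|hdot u w| <= c) ->
  exists c, forall w, S w -> `|w| <= c.
Proof.
move=> Sb; apply: contrapT => nS.
have big (c : C) : 0 <= c -> {w | S w & c < `|w|}.
  move=> c0; apply: cid2; apply: contrapT => nw; apply: nS; exists c => w Sw.
  rewrite real_leNgt ?ger0_real //; apply/negP => cw; apply: nw.
  by exists w.
pose rho n : C := 3%:R ^- n.
have rho_gt0 n : 0 < rho n by rewrite invr_gt0 exprn_gt0.
have rhoS n : rho n = rho n.+1 * 3%:R.
  by rewrite /rho exprS invfM mulrAC mulVf ?mul1r.
have c_ge0 n : 0 <= n%:R * 3%:R ^+ n :> C by rewrite mulr_ge0 ?exprn_ge0.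
pose w n := s2val (big _ (c_ge0 n)).
have wS n : S (w n) by rewrite /w; case: (big _ _).
have wn n : n%:R < rho n * `|w n|.
  by rewrite mulrC ltr_pdivlMr ?exprn_gt0 //; rewrite /w; case: (big _ _).
have w0 n : 0 < `|w n|.
  by have := le_lt_trans (ler0n _ n) (wn n); rewrite pmulr_rgt0.
pose y n : H := (rho n / `|w n|) *: w n.
have yn n : `|y n| = rho n.
  by rewrite normrZ ger0_norm ?divr_ge0 ?(ltW (rho_gt0 n)) // divfK ?gt_eqF.
have yw n : hdot (y n) (w n) = rho n * `|w n|.
  by rewrite hdotZl -hdot_norm expr2 mulrA divfK ?gt_eqF.
pose step n x := if rho n * `|w n| <= `|hdot (x + y n) (w n)| then x + y n
                 else x - y n.
pose x := fix x n := if n is m.+1 then step m (x m) else 0.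
(* one of the two directions works as |a + b| and |a - b| add up to at least 2 |b| *)
have stepw n z : rho n * `|w n| <= `|hdot (step n z) (w n)|.
  rewrite /step; case: ifPn => //.
  rewrite -real_ltNge ?ger0_real ?mulr_ge0 ?(ltW (rho_gt0 _)) // => lt.
  have : `|hdot (y n) (w n)| *+ 2 <= `|hdot (z + y n) (w n)| + `|hdot (z - y n) (w n)|.
    rewrite -normrMn mulr2n -hdotDl.
    rewrite (_ : y n + y n = (z + y n) - (z - y n)); last first.
      by rewrite opprB [RHS]addrC subrKA.
    by rewrite hdotBl ler_normB.
  rewrite yw ger0_norm ?mulr_ge0 ?(ltW (rho_gt0 _)) // mulr2n => le.
  by rewrite -(lerD2l (rho n * `|w n|)) (le_trans le) // lerD2r ltW.
have xS n : `|x n.+1 - x n| <= rho n.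
  rewrite /= /step; case: ifP => _; first by rewrite addrC addKr yn.
  by rewrite addrC addKr normrN yn.
(* the sum of the geometric series from n on *)
pose e n := 3%:R / 2%:R * rho n.
have e_gt0 n : 0 < e n by rewrite !mulr_gt0 ?invr_gt0.
have xk n k : `|x (n + k)%N - x n| <= e n - e (n + k)%N.
  elim: k => [|k IH]; first by rewrite addn0 !subrr normr0.
  rewrite addnS -(subrKA (x (n + k)%N)) (le_trans (ler_normD _ _)) //.
  apply: le_trans (lerD (xS _) IH) _.
  by rewrite /e (rhoS (n + k)%N) le_eqVlt; apply/orP; left; apply/eqP; field.
have xe n m : `|x n - x m| <= e n + e m.
  wlog nm : n m / (n <= m)%N.
    move=> W; case: (leqP n m) => [/W //|/ltnW/W le]; by rewrite distrC [leRHS]addrC.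
  rewrite distrC -(subnKC nm) (le_trans (xk _ _)) //.
  by rewrite lerD2l (le_trans (_ : _ <= 0)) ?oppr_le0 // ltW.
have [d d0|z zx] := hilbert_limit _ xe.
  have [|N Nd] := @harmonic_small _ (d * 2%:R / 3%:R).
    by rewrite divr_gt0 ?mulr_gt0.
  exists N => n /Nd le; rewrite /e mulrAC ler_pdivrMr // mulrC -ler_pdivlMr //.
  apply: le_trans le; rewrite lef_pV2 ?posrE ?exprn_gt0 // -natrX ler_nat.
  exact: ltn_expl.
have [c cP] := Sb z.
have half n : rho n * `|w n| <= `|hdot z (w n)| *+ 2.
  have h1 : `|hdot (x n.+1) (w n)| <= `|hdot z (w n)| + rho n * `|w n| / 2%:R.
    rewrite -[hdot (x _) _](subrK (hdot z (w n))) addrC (le_trans (ler_normD _ _)) //.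
    rewrite lerD2l -hdotBl (le_trans (hdot_cs _ _)) // mulrAC ler_wpM2r //.
    apply: le_trans (zx _) _; rewrite /e (rhoS n).
    by rewrite le_eqVlt; apply/orP; left; apply/eqP; field.
  have := le_trans (stepw n (x n)) h1; rewrite -lerBlDr.
  rewrite (_ : _ - _ = rho n * `|w n| / 2%:R); last by field.
  by rewrite ler_pdivrMr // mulr_natr.
have c0 : 0 <= c by rewrite (le_trans _ (cP _ (wS 0))).
have : forall n, n%:R < c *+ 2 :> C.
  by move=> n; rewrite (lt_le_trans (wn n)) // (le_trans (half n)) // lerMn2r cP.
have [c20|c20] := eqVneq c 0; first by move=> /(_ 0); rewrite c20 mul0rn ltxx.
have [|N /(_ N (leqnn N)) Nc] := @harmonic_small R (c *+ 2)^-1.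
  by rewrite invr_gt0 pmulrn_lgt0 // lt_def c20.
move=> /(_ N.+1); apply/negP; rewrite -real_leNgt ?ger0_real ?mulrn_wge0 //.
by move: Nc; rewrite lef_pV2 ?posrE // pmulrn_lgt0 // lt_def c20.
Qed.

End UniformBoundedness.

(** * Multiplication operators on total families *)

(** For a reproducing kernel space this is injectivity of the evaluation map;
    by [total_dense] and [dense_total] it is equivalent to density of the
    span. *)
Definition total (R : realType) (Z : Type) (H : hilbertType R) (kap : Z -> H) :=
  forall u, (forall z, hdot u (kap z) = 0) -> u = 0.

Section Total.
Variables (R : realType) (Z : Type) (H : hilbertType R) (kap : Z -> H).
Local Notation C := R[i].

Lemma total_eq u v : total kap ->
  (forall z, hdot u (kap z) = hdot v (kap z)) -> u = v.
Proof.
by move=> tot uv; apply/subr0_eq/tot => z; rewrite hdotBl uv subrr.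
Qed.

Lemma total_id : total (@id H).
Proof. by move=> u u0; apply: hdot_eq0; apply: u0. Qed.

Lemma closure_dense (u : H) (e : C) : closure (range (comb kap)) u ->
  0 < e -> exists l, `|u - comb kap l| <= e.
Proof.
move=> /closureP_norm ucl e0.
by have [_ [l _ <-] ul] := ucl e e0; exists l.
Qed.

Lemma dense_total : (forall u, closure (range (comb kap)) u) -> total kap.
Proof.
move=> dense u u0; apply: hdot_eq0; apply: (@small_mul_eq0 _ _ _ `|u|) => // d d0 _.
have [l ul] := closure_dense (dense u) d0.
have ul0 : hdot u (comb kap l) = 0.
  by rewrite hdot_combr /pair big1 // => p _; rewrite u0 mulr0.
by rewrite -[hdot u u]subr0 -ul0 -hdotBr (le_trans (hdot_cs _ _)) // ler_wpM2l.
Qed.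

Lemma total_dense (u : H) : total kap -> closure (range (comb kap)) u.
Proof.
move=> tot; have [//||g [gcl gE _]] :=
  @riesz_family _ _ _ kap (fun z => hdot u (kap z)) `|u|.
  by move=> l; rewrite -hdot_combr hdot_cs.
by rewrite -(total_eq tot gE).
Qed.

(** The adjoint of pointwise multiplication by [m] sends kap z to
    conj (m z) kap z; this is its action on formal combinations. *)
Definition mscal (m : Z -> C) (l : seq (C * Z)) : seq (C * Z) :=
  [seq ((m p.2)^* * p.1, p.2) | p <- l].

Lemma pair_mscal m (f : Z -> C) l :
  pair f (mscal m l) = pair (fun z => m z * f z) l.
Proof.
rewrite /pair /mscal big_map; apply: eq_bigr => p _ /=.
by rewrite rmorphM /= conjCK mulrCA mulrA.
Qed.

(** Multiplication by [m] as the adjoint of a bounded operator on the span. *)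
Lemma family_multiplier m (c : C) : 0 <= c ->
    (forall l, `|comb kap (mscal m l)| <= c * `|comb kap l|) ->
  forall u, exists2 g, forall z, hdot g (kap z) = m z * hdot u (kap z) &
                       `|g| <= c * `|u|.
Proof.
move=> c0 mc u.
have [||g [_ gE gc]] := @riesz_family _ _ _ kap (fun z => m z * hdot u (kap z))
                          (c * `|u|).
- by rewrite mulr_ge0.
- move=> l; rewrite -(pair_mscal m (fun z => hdot u (kap z))) -hdot_combr.
  by rewrite (le_trans (hdot_cs _ _)) // [leRHS]mulrAC [leRHS]mulrC ler_wpM2l.
by exists g.
Qed.

(** A function that multiplies the whole space is a bounded multiplier.  The
    images of unit combinations under the adjoint are pointwise bounded, since
    their inner product with u equals that of the combination with the product
    m u, so [uniform_boundedness] applies. *)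
Lemma family_multiplier_bounded m :
    (forall u, exists g, forall z, hdot g (kap z) = m z * hdot u (kap z)) ->
  exists2 c : C, 0 <= c &
    forall l, `|comb kap (mscal m l)| <= c * `|comb kap l|.
Proof.
move=> mE.
(* N instead of the norm itself, which may be 0 *)
pose S := [set w | exists l (N : C),
  [/\ 0 < N, `|comb kap l| <= N & w = N^-1 *: comb kap (mscal m l)]].
have [u|c cP] := @uniform_boundedness _ H S.
  have [g gE] := mE u; exists `|g| => _ [l [N [N0 lN ->]]].
  have -> : hdot u (N^-1 *: comb kap (mscal m l)) = N^-1 * hdot g (comb kap l).
    rewrite hdotZr geC0_conj ?invr_ge0 ?(ltW N0) //; congr (_ * _).
    rewrite !hdot_combr pair_mscal; congr (pair _ l).
    by apply/funext => z; rewrite gE.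
  rewrite normrM gtr0_norm ?invr_gt0 // ler_pdivrMl // mulrC.
  by rewrite (le_trans (hdot_cs _ _)) // ler_wpM2l.
have c0 : 0 <= c.
  rewrite (le_trans _ (cP 0 _)) //; exists [::], 1.
  by rewrite /= !comb_nil normr0 ler01 ltr01 scaler0.
exists c => // l; apply/ler_addgt0Pr => d d0.
have c1 : 0 < c + 1 by rewrite ltr_wpDl.
pose N := `|comb kap l| + d / (c + 1).
have N0 : 0 < N by rewrite ltr_wpDl // divr_gt0.
have := cP (N^-1 *: comb kap (mscal m l)) _.
rewrite normrZ gtr0_norm ?invr_gt0 // ler_pdivrMl // => le.
apply: le_trans (le _) _.
  by exists l, N; split => //; rewrite lerDl ltW // divr_gt0.
rewrite /N mulrDl mulrC lerD2l mulrAC ler_pdivrMr // mulrDr mulr1.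
by rewrite lerDl ltW.
Qed.

(** The quadratic form of this kernel at l is c^2 |comb l|^2 minus the squared
    norm of the adjoint applied to comb l. *)
Lemma mscal_boundP m (c : C) : 0 <= c ->
  (forall l, `|comb kap (mscal m l)| <= c * `|comb kap l|) <->
  psd_kernel (fun z w => (c ^+ 2 - (m z)^* * m w) * gram kap z w).
Proof.
move=> c0; rewrite psd_kernelP.
have E l : form (fun z w => (c ^+ 2 - (m z)^* * m w) * gram kap z w) l l =
           (c * `|comb kap l|) ^+ 2 - `|comb kap (mscal m l)| ^+ 2.
  rewrite exprMn !hdot_norm -!form_gram /form !pair_comb.
  rewrite mulr_sumr /mscal big_map -sumrB; apply: eq_bigr => p _.
  rewrite mulr_sumr big_map -sumrB; apply: eq_bigr => q _ /=.
  by rewrite rmorphM /= conjCK; ring.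
split=> [mc l|mc l].
  by rewrite E subr_ge0 lerXn2r ?nnegrE ?mulr_ge0.
by have := mc l; rewrite E subr_ge0 ler_sqr ?nnegrE ?mulr_ge0.
Qed.

End Total.

Definition linear_pack (R : realType) (U V : lmodType R[i]) (f : U -> V)
  (lf : linear f) : {linear U -> V} :=
  HB.pack f (GRing.isLinear.Build _ _ _ _ _ lf).

Lemma bounded_of_continuous (R : realType) (H G : hilbertType R) (A : H -> G) :
  linear A -> continuous A ->
  exists2 c : R[i], 0 < c & forall u, `|A u| <= c * `|u|.
Proof. by move=> lA cA; apply: (@continuous_bounded _ _ _ (linear_pack lA)). Qed.

Lemma linear_total (R : realType) (Z : Type) (H G : hilbertType R) (kap : Z -> H)
    (A : G -> H) (m : G -> Z -> R[i]) : total kap ->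
  (forall u z, hdot (A u) (kap z) = m u z) -> (forall z, scalar (m^~ z)) -> linear A.
Proof.
move=> tot AE mlin a u v; apply: (total_eq tot) => z.
by rewrite hdotDl hdotZl !AE mlin.
Qed.

Section Rkhs.
Variables (R : realType) (X : Type) (k : X -> X -> R[i]) (H : rkhs k).
Local Notation C := R[i].

Lemma rkhs_kernel_total : total (rkhs_kernel H).
Proof.
move=> u u0; apply: (rkhs_eval_inj (r := H)); apply/funext => x.
rewrite -!rkhs_reproducing u0 hdot0l //.
Qed.

Lemma rkhs_kernel_dot x y : hdot (rkhs_kernel H x) (rkhs_kernel H y) = k y x.
Proof. by rewrite rkhs_reproducing rkhs_kernelE. Qed.

Lemma rkhs_psd : psd_kernel k.
Proof.
have := psd_conjT (psd_gram (rkhs_kernel H)); congr psd_kernel.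
by apply/funext => x; apply/funext => y; rewrite /gram rkhs_kernel_dot.
Qed.

Lemma gram_rkhs : gram (rkhs_kernel H) = (fun x y => k y x).
Proof. by apply/funext => x; apply/funext => y; rewrite /gram rkhs_kernel_dot. Qed.

(** Multipliers are recognized from kernels alone.  The right-hand side can be
    multiplied by other kernels, which is how multipliers are transported from
    one space to another. *)
Lemma MultP (phi : X -> C) :
  Mult H phi <->
  exists2 c : C, 0 <= c &
    psd_kernel (fun x y => (c ^+ 2 - phi x * (phi y)^*) * k x y).
Proof.
have E (c : C) : psd_kernel (fun x y => (c ^+ 2 - phi x * (phi y)^*) * k x y) <->
  psd_kernel (fun x y => (c ^+ 2 - (phi x)^* * phi y) * gram (rkhs_kernel H) x y).
  rewrite gram_rkhs; split=> /psd_conjT; congr psd_kernel;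
    by apply/funext => x; apply/funext => y; rewrite [_^* * _]mulrC.
split=> [M|[c c0 /E/(mscal_boundP _ _ c0) mc] f].
  have [u|c c0 mc] := @family_multiplier_bounded _ _ _ (rkhs_kernel H) phi.
    have [g gE] := M u; exists g => x; rewrite !rkhs_reproducing; exact: gE.
  by exists c => //; apply/E/mscal_boundP.
have [g gE _] := family_multiplier c0 mc f.
by exists g => x; rewrite -!rkhs_reproducing.
Qed.

Lemma MopE (phi : X -> C) f x :
  Mult H phi -> rkhs_eval H (Mop phi f) x = phi x * rkhs_eval H f x.
Proof.
move=> M; rewrite /Mop /mulop; have [g gE] := M f.
by case: xgetP => [h _ hE|/(_ g)//]; apply: hE.
Qed.

End Rkhs.

(** * Tensor products of reproducing kernel spaces *)

Section Tensor.
Variables (R : realType) (H E : hilbertType R) (T : hilbert_tensor H E).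
Local Notation C := R[i].

Lemma tensDl (f g : H) (u : E) : tens T (f + g) u = tens T f u + tens T g u.
Proof. by rewrite linearDl. Qed.
Lemma tensZl a (f : H) (u : E) : tens T (a *: f) u = a *: tens T f u.
Proof. by rewrite linearZl_LR. Qed.
Lemma tensDr (f : H) (u v : E) : tens T f (u + v) = tens T f u + tens T f v.
Proof. by rewrite linearDr. Qed.
Lemma tensZr a (f : H) (u : E) : tens T f (a *: u) = a *: tens T f u.
Proof. by rewrite linearZr_LR. Qed.

Lemma tens0l (u : E) : tens T 0 u = 0.
Proof. by have := tensZl 0 0 u; rewrite !scale0r. Qed.
Lemma tens0r (f : H) : tens T f 0 = 0.
Proof. by have := tensZr 0 f 0; rewrite !scale0r. Qed.

Lemma tens_norm (f : H) (u : E) : `|tens T f u| = `|f| * `|u|.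
Proof.
apply/eqP; rewrite -(eqrXn2 (n := 2)) ?mulr_ge0 //.
by rewrite exprMn !hdot_norm tens_dot.
Qed.

Lemma tens_comb_l (l : seq (C * H)) (u : E) :
  comb (fun f => tens T f u) l = tens T (comb id l) u.
Proof.
elim: l => [|[a f] l IH]; first by rewrite !comb_nil tens0l.
by rewrite -cat1s !comb_cat !comb1 IH tensDl tensZl.
Qed.

Lemma tens_comb_r (l : seq (C * E)) (f : H) :
  comb (fun u => tens T f u) l = tens T f (comb id l).
Proof.
elim: l => [|[a u] l IH]; first by rewrite !comb_nil tens0r.
by rewrite -cat1s !comb_cat !comb1 IH tensDr tensZr.
Qed.

Lemma tens_approx (t : T) (e : C) : 0 < e -> exists n (f : 'I_n -> H) (u : 'I_n -> E),
  `|t - \sum_(i < n) tens T (f i) (u i)| <= e.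
Proof.
move=> e0; have : setT t by []; rewrite -(tens_dense T).
by move=> /closureP_norm/(_ e e0)[_ [n [f [u ->]]] te]; exists n, f, u.
Qed.

(** Identities between continuous additive maps can be checked on elementary
    tensors, since their sums are dense. *)
Lemma tens_ext (V : normedZmodType C) (D : T -> V) (c : C) :
    0 <= c -> zmod_morphism D -> (forall t, `|D t| <= c * `|t|) ->
    (forall f u, D (tens T f u) = 0) ->
  forall t, D t = 0.
Proof.
move=> c0 DB Dc D0 t; have D00 : D 0 = 0 by rewrite -(subrr 0) DB subrr.
have DD s s' : D (s + s') = D s + D s'.
  by rewrite -[s' in LHS]opprK DB -[- s']sub0r DB D00 sub0r opprK.
have Dsum n (f : 'I_n -> H) (u : 'I_n -> E) : D (\sum_(i < n) tens T (f i) (u i)) = 0.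
  elim: n f u => [|n IH] f u; first by rewrite big_ord0.
  by rewrite big_ord_recl DD D0 IH addr0.
apply: (@small_mul_eq0 _ _ _ c) => // d d0 _.
have [n [f [u tu]]] := tens_approx t d0.
by rewrite -[D t]subr0 -(Dsum _ f u) -DB (le_trans (Dc _)) // ler_wpM2l.
Qed.

Lemma tens_total : total (fun p : H * E => tens T p.1 p.2).
Proof.
move=> t t0; apply: hdot_eq0.
apply: (@tens_ext _ (fun s => hdot t s) `|t|) => // [s s'|s|f u].
- by rewrite hdotBr.
- exact: hdot_cs.
- exact: (t0 (f, u)).
Qed.

End Tensor.

Section RkhsTensor.
Variables (R : realType) (X : Type) (k : X -> X -> R[i]) (H : rkhs k).
Variables (E : hilbertType R) (T : rkhs_tensor H E).
Local Notation C := R[i].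

Definition kernel_tensor (p : X * E) : T := tens T (rkhs_kernel H p.1) p.2.

Lemma gram_kernel_tensor :
  gram kernel_tensor = (fun p q => k q.1 p.1 * hdot p.2 q.2).
Proof.
apply/funext => p; apply/funext => q.
by rewrite /gram tens_dot rkhs_kernel_dot.
Qed.

(** Both sides are continuous in t and agree on elementary tensors: evaluation
    at x is the adjoint of tensoring with the kernel at x. *)
Lemma tensor_eval_dot t x u :
  hdot (tensor_eval T t x) u = hdot t (kernel_tensor (x, u)).
Proof.
have [c c0 ev_le] := bounded_of_continuous (@tensor_eval_linear _ _ _ _ _ T x)
  (@tensor_eval_continuous _ _ _ _ _ T x).
have evB t1 t2 : tensor_eval T t1 x - tensor_eval T t2 x = tensor_eval T (t1 - t2) x.
  by rewrite addrC -scaleN1r -tensor_eval_linear scaleN1r addrC.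
pose D t := hdot (tensor_eval T t x) u - hdot t (kernel_tensor (x, u)).
apply/subr0_eq/(@tens_ext _ _ _ T _ D (c * `|u| + `|kernel_tensor (x, u)|)).
- by rewrite addr_ge0 ?mulr_ge0 // ltW.
- by move=> s s'; rewrite /D -evB !hdotBl; ring.
- move=> s; rewrite /D (le_trans (ler_normB _ _)) // mulrDl lerD //.
    rewrite (le_trans (hdot_cs _ _)) // mulrAC ler_wpM2r //.
  by rewrite (le_trans (hdot_cs _ _)) // mulrC.
- move=> f v; rewrite /D tensor_evalE tens_dot rkhs_reproducing hdotZl.
  by rewrite subrr.
Qed.

(** For fixed t and u the map f |-> <t, f (x) u> is represented by some g in
    [H], which vanishes at every point when t is orthogonal to the kernel
    tensors. *)
Lemma kernel_tensor_total : total kernel_tensor.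
Proof.
move=> t t0; apply: (@tens_total _ _ _ T) => -[f u] /=.
have [||g [_ gE _]] := @riesz_family _ _ _ id (fun f => hdot t (tens T f u))
                         (`|t| * `|u|).
- by rewrite mulr_ge0.
- move=> l; rewrite -(hdot_combr (fun f => tens T f u)) tens_comb_l.
  by rewrite (le_trans (hdot_cs _ _)) // tens_norm -mulrA [_ * `|u|]mulrC.
rewrite -gE (_ : g = 0) ?hdot0l //; apply: (rkhs_kernel_total (H := H)) => x.
by rewrite gE (t0 (x, u)).
Qed.

Lemma kernel_tensor_dense (t : T) (e : C) :
  0 < e -> exists l, `|t - comb kernel_tensor l| <= e.
Proof. exact/closure_dense/total_dense/kernel_tensor_total. Qed.

Lemma tensor_eval_inj (t t' : T) :
  (forall x, tensor_eval T t x = tensor_eval T t' x) -> t = t'.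
Proof.
move=> tt'; apply: (total_eq kernel_tensor_total) => -[x u].
by rewrite -!tensor_eval_dot tt'.
Qed.

(** Positivity is inherited from [k] by the Schur product with the Gram matrix
    of the second factors. *)
Lemma kernel_tensor_mscal (phi : X -> C) (c : C) : 0 <= c ->
    psd_kernel (fun x y => (c ^+ 2 - phi x * (phi y)^*) * k x y) ->
  forall l, `|comb kernel_tensor (mscal (phi \o fst) l)| <= c * `|comb kernel_tensor l|.
Proof.
move=> c0 phi0; apply/mscal_boundP => //; rewrite gram_kernel_tensor.
have := psd_mul (psd_pull fst (psd_conjT phi0)) (psd_gram (@snd X E)).
congr psd_kernel; apply/funext => p; apply/funext => q.
by rewrite /gram /= [_ * _^*]mulrC mulrA.
Qed.

Lemma tensor_multiplier (phi : X -> C) (c : C) : 0 <= c ->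
    psd_kernel (fun x y => (c ^+ 2 - phi x * (phi y)^*) * k x y) ->
  exists A : {linear T -> T}, continuous A /\
    forall t x, tensor_eval T (A t) x = phi x *: tensor_eval T t x.
Proof.
move=> c0 phi0; have mc := kernel_tensor_mscal c0 phi0.
have /choice[A AP] : forall t : T, exists g : T,
    (forall p, hdot g (kernel_tensor p) = phi p.1 * hdot t (kernel_tensor p)) /\
    `|g| <= c * `|t|.
  by move=> t; have [g] := family_multiplier c0 mc t; exists g.
have linA : linear A.
  apply: (linear_total kernel_tensor_total (fun t => (AP t).1)) => p a t t'.
  by rewrite hdotDl hdotZl; ring.
exists (linear_pack linA); split.
  exact: (bounded_continuous c0 linA (fun t => (AP t).2)).
move=> t x; apply: hdot_inj => u; apply: (can_inj conjCK).
rewrite -!hdotC tensor_eval_dot hdotZl tensor_eval_dot.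
exact: (AP t).1.
Qed.

Lemma tensor_eval_mul (phi : X -> C) (A : {linear T -> T}) :
    continuous A -> Mult H phi ->
    (forall f u, A (tens T f u) = tens T (Mop phi f) u) ->
  forall t x, tensor_eval T (A t) x = phi x *: tensor_eval T t x.
Proof.
move=> cA M AE t x.
have [c c0 ev_le] := bounded_of_continuous (@tensor_eval_linear _ _ _ _ _ T x)
  (@tensor_eval_continuous _ _ _ _ _ T x).
have [d d0 A_le] := continuous_bounded cA.
have evB t1 t2 : tensor_eval T (t1 - t2) x = tensor_eval T t1 x - tensor_eval T t2 x.
  by rewrite addrC -scaleN1r tensor_eval_linear scaleN1r addrC.
pose D t := tensor_eval T (A t) x - phi x *: tensor_eval T t x.
apply/subr0_eq/(@tens_ext _ _ _ T _ D (c * d + `|phi x| * c)).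
- by rewrite addr_ge0 ?mulr_ge0 // ltW.
- by move=> s s'; rewrite /D linearB !evB scalerBr opprD addrACA -opprD.
- move=> s; rewrite /D (le_trans (ler_normB _ _)) // mulrDl lerD //.
    by rewrite (le_trans (ev_le _)) // -mulrA ler_wpM2l // ltW.
  by rewrite normrZ -mulrA ler_wpM2l.
- by move=> f v; rewrite /D AE !tensor_evalE MopE // scalerA subrr.
Qed.

End RkhsTensor.

(** * Existence of the tensor product *)

Section TensorExists.
Variables (R : realType) (X : Type) (s : X -> X -> R[i]) (H : rkhs s).
Variable F : hilbertType R.
Local Notation C := R[i].

(** The product of two inner products is a kernel on pairs of vectors by the
    Schur product theorem; its Hilbert space is the tensor product.
    Bilinearity is tested against the total family of elementary tensors. *)
Lemma hilbert_tensor_exists (G : hilbertType R) : inhabited (hilbert_tensor G F).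
Proof.
pose K (p q : G * F) := hdot p.1 q.1 * hdot p.2 q.2.
have K0 : psd_kernel K.
  exact: (psd_mul (psd_gram (@fst G F)) (psd_gram (@snd G F))).
have [T [kap [kapE dense]]] := kolmogorov K0.
pose ten f u := kap (f, u).
have ten_lin : bilinear_for *:%R *:%R ten.
  split=> [u a f g|f a u v]; apply: (total_eq (dense_total dense)) => z.
    by rewrite hdotDl hdotZl !kapE /K /= hdotDl hdotZl; ring.
  by rewrite hdotDl hdotZl !kapE /K /= hdotDl hdotZl; ring.
pose B : {bilinear G -> F -> T} :=
  HB.pack ten (bilinear_isBilinear.Build C G F T *:%R *:%R ten ten_lin).
constructor; apply: (@HilbertTensor R G F T B) => [f g u v|].
  exact: kapE.
apply/seteqP; split=> // t _; apply: closureS (dense t) => _ [l _ <-].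
exists (size l), (fun i => (tnth (in_tuple l) i).1 *: (tnth (in_tuple l) i).2.1),
  (fun i => (tnth (in_tuple l) i).2.2).
rewrite /comb big_tnth; apply: eq_bigr => i _.
rewrite linearZl_LR; congr (_ *: _).
by rewrite /B /= /ten; case: (tnth _ _) => ? [].
Qed.

Lemma rkhs_tensor_exists : inhabited (rkhs_tensor H F).
Proof.
have [T] := hilbert_tensor_exists H.
have /choice[ev0 ev0P] : forall tx : T * X, exists g : F,
    (forall v, hdot g v = hdot tx.1 (tens T (rkhs_kernel H tx.2) v)) /\
    `|g| <= `|rkhs_kernel H tx.2| * `|tx.1|.
  move=> [t x] /=; have [||g [_ gE gc]] := @riesz_family _ _ _ id
    (fun v => hdot t (tens T (rkhs_kernel H x) v)) (`|rkhs_kernel H x| * `|t|).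
  - by rewrite mulr_ge0.
  - move=> l; rewrite -(hdot_combr (fun v => tens T (rkhs_kernel H x) v)).
    by rewrite tens_comb_r (le_trans (hdot_cs _ _)) // tens_norm mulrA [_ * `|t|]mulrC.
  by exists g.
pose ev t x := ev0 (t, x).
have evE t x v : hdot (ev t x) v = hdot t (tens T (rkhs_kernel H x) v).
  exact: (ev0P (t, x)).1.
have ev_lin x : linear (ev^~ x).
  apply: (linear_total (@total_id _ F) (evE^~ x)) => v a t t'.
  by rewrite hdotDl hdotZl.
constructor; apply: (@RKHSTensor _ _ _ _ _ T ev) => // [x|f u x].
  apply: (@bounded_continuous _ _ _ (ev^~ x) `|rkhs_kernel H x|) => // t.
  exact: (ev0P (t, x)).2.
apply: (total_eq (@total_id _ F)) => v.
by rewrite evE tens_dot rkhs_reproducing hdotZl.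
Qed.

End TensorExists.

(** * The invariant subspace theorem *)

Section Main.
Variables (R : realType) (X : Type) (k s : X -> X -> R[i]).
Local Notation C := R[i].
Hypothesis s_neq0 : forall x y, s x y != 0.
Hypothesis ks0 : psd_kernel (fun x y => k x y / s x y).
Variables (Hk : rkhs k) (Hs : rkhs s) (E : hilbertType R) (T : rkhs_tensor Hk E).

Lemma mulop_tensorE (F : hilbertType R) (S : rkhs_tensor Hs F)
    (Phi : X -> F -> E) f x :
  multiplier (tensor_eval S) (tensor_eval T) Phi ->
  tensor_eval T (mulop (tensor_eval S) (tensor_eval T) Phi f) x =
  Phi x (tensor_eval S f x).
Proof.
move=> M; have [g gE] := M f; rewrite /mulop.
by case: xgetP => [h _ hE|/(_ g)//]; apply: hE.
Qed.

(** Schur product with k / s. *)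
Lemma multiplier_bound_transfer (phi : X -> C) (c : C) :
  psd_kernel (fun x y => (c ^+ 2 - phi x * (phi y)^*) * s x y) ->
  psd_kernel (fun x y => (c ^+ 2 - phi x * (phi y)^*) * k x y).
Proof.
move=> /psd_mul/(_ ks0); congr psd_kernel.
by apply/funext => x; apply/funext => y; field.
Qed.

(** Each Phi x is linear, so that phi x Phi x (f x) = Phi x (phi x f x); the
    product phi f belongs to the space because phi is a bounded multiplier. *)
Lemma range_invariant (F : hilbertType R) (S : rkhs_tensor Hs F)
    (Phi : X -> {linear F -> E}) :
  multiplier (tensor_eval S) (tensor_eval T) Phi ->
  Mult_invariant Hs (range (mulop (tensor_eval S) (tensor_eval T) Phi)).
Proof.
move=> PhiM phi /MultP[c c0 phis].
have phik := multiplier_bound_transfer phis.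
have phiM : Mult Hk phi by apply/MultP; exists c.
have [A [cA AE]] := tensor_multiplier T c0 phik.
have [B [_ BE]] := tensor_multiplier S c0 phis.
split=> //; exists A; split=> // [f u|_ [_ [f _ <-] <-]].
  apply: tensor_eval_inj => x.
  by rewrite AE !tensor_evalE MopE // scalerA.
exists (B f) => //; apply: tensor_eval_inj => x.
by rewrite AE !mulop_tensorE // BE linearZ.
Qed.

(* From here on P is the orthogonal projection onto the closed subspace M. *)
Variables (M : set T) (M_closed : closed_subspace M).
Variable P : T -> T.
Hypothesis PM : forall t, M (P t).
Hypothesis PE : forall t m, M m -> hdot (P t) m = hdot t m.
Local Notation kt := (kernel_tensor T).
(* The Gram matrix of kap is the reproducing kernel of M. *)
Let kap p := P (kt p).

Lemma M_comb l : M (comb kap l).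
Proof.
have [_ M0 Mlin] := M_closed.
elim: l => [|[a p] l IH]; first by rewrite comb_nil.
by rewrite -cat1s comb_cat comb1; apply: Mlin => //; exact: PM.
Qed.

Lemma dot_comb_proj m l : M m -> hdot m (comb kap l) = hdot m (comb kt l).
Proof.
move=> Mm; rewrite !hdot_combr; congr (pair _ l); apply/funext => p.
by rewrite hdotC /kap PE // -hdotC.
Qed.

Lemma norm_comb_proj l : `|comb kap l| <= `|comb kt l|.
Proof.
apply: norm_le_dot => //; rewrite hdot_norm dot_comb_proj; last exact: M_comb.
rewrite -[X in X <= _]ger0_norm; first by rewrite (le_trans (hdot_cs _ _)) // mulrC.
by rewrite -(dot_comb_proj _ (M_comb l)) -hdot_norm exprn_ge0.
Qed.

Section Invariant.
Hypothesis s0 : psd_kernel s.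
Hypothesis M_inv : Mult_invariant Hs M.

(* A partial Cholesky factorization of 1 - 1/s. *)
Variables (bs : seq (X -> C)).
Hypothesis bs0 :
  psd_kernel (fun x y => 1 - (s x y)^-1 - \sum_(b <- bs) b x * (b y)^*).

(** s (1 - b b^* ) is 1 plus s times the remaining part of 1 - 1/s, hence
    positive semi-definite: b is a contractive multiplier. *)
Lemma factor_multiplier b : b \in bs -> Mult Hs b.
Proof.
move=> bin; apply/MultP; exists 1 => //.
have := psd_add (@psd_one R X)
  (psd_mul s0 (psd_add bs0 (psd_sum_rank1 (rem b bs)))).
congr psd_kernel; apply/funext => x; apply/funext => y.
rewrite (perm_big _ (perm_to_rem bin)) big_cons /=.
rewrite expr1n; set S := \sum_(_ <- _) _; field; exact: s_neq0.
Qed.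

(** The adjoint of the row of multiplication operators by the functions b is
    contractive on the full space: k (1 - sum of b b^* ) is k / s plus k times
    a positive semi-definite kernel. *)
Lemma factor_row_contractive l :
  \sum_(b <- bs) `|comb kt (mscal (b \o fst) l)| ^+ 2 <= `|comb kt l| ^+ 2.
Proof.
rewrite -subr_ge0.
pose L (x y : X) := 1 - (s x y)^-1 - \sum_(b <- bs) b x * (b y)^*.
have kL : psd_kernel (fun x y => k x y / s x y + k x y * L x y).
  apply: psd_add => //; apply: psd_mul => //; exact: rkhs_psd Hk.
have := psd_mul (psd_pull fst (psd_conjT kL)) (psd_gram (@snd X E)).
move=> /psd_kernelP/(_ l); congr (_ <= _).
have -> : \sum_(b <- bs) `|comb kt (mscal (b \o fst) l)| ^+ 2 =
  \sum_(p <- l) \sum_(q <- l) \sum_(b <- bs)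
    ((b p.2.1)^* * p.1 * gram kt p.2 q.2 * ((b q.2.1)^* * q.1)^*).
  under eq_bigr => b _ do rewrite hdot_norm -form_gram /form pair_comb big_map.
  rewrite exchange_big; apply: eq_bigr => p _.
  under eq_bigr => b _ do rewrite big_map.
  by rewrite exchange_big.
rewrite hdot_norm -form_gram /form !pair_comb -sumrB; apply: eq_bigr => p _.
rewrite -sumrB; apply: eq_bigr => q _ /=.
rewrite gram_kernel_tensor /L /gram /=.
set Y := k q.2.1 p.2.1 * hdot p.2.2 q.2.2.
have -> : \sum_(b <- bs) (b p.2.1)^* * p.1 * Y * ((b q.2.1)^* * q.1)^* =
    (\sum_(b <- bs) b q.2.1 * (b p.2.1)^*) * (p.1 * Y * q.1^*).
  rewrite mulr_suml; apply: eq_bigr => b _.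
  by rewrite rmorphM /= conjCK; ring.
by rewrite /Y; set S := \sum_(_ <- _) _; ring.
Qed.

(** The row of multiplication operators stays contractive on the invariant
    subspace M, and so does its adjoint, which maps h = comb kap l to the
    vectors hb b.  Write S for the sum of |hb b|^2 and g for the sum of
    A b (hb b), the row applied to its own adjoint at h, so that <g, h> = S.
    For w in the span of the kernel tensors, 2 Re <g, w> is at most
    S + |w|^2 by [factor_row_contractive] and 2 Re <a, b> <= |a|^2 + |b|^2;
    letting w tend to h gives 2 S <= S + |h|^2. *)
Lemma row_contractive l :
  \sum_(b <- bs) `|comb kap (mscal (b \o fst) l)| ^+ 2 <= `|comb kap l| ^+ 2.
Proof.
have /choice[A AP] : forall b, exists A : T -> T, b \in bs ->
    (forall t x, tensor_eval T (A t) x = b x *: tensor_eval T t x) /\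
    forall m, M m -> M (A m).
  move=> b; case: (boolP (b \in bs)) => [bin|_]; last by exists id.
  have [bk [A [cA AE AM]]] := M_inv (factor_multiplier bin); exists A => _; split.
    exact: tensor_eval_mul.
  by move=> m Mm; apply: AM; exists m.
have Akt b m l' : b \in bs ->
    hdot (A b m) (comb kt l') = hdot m (comb kt (mscal (b \o fst) l')).
  move=> bin; rewrite !hdot_combr pair_mscal; congr (pair _ l').
  apply/funext => -[x u] /=.
  by rewrite -!tensor_eval_dot (AP b bin).1 hdotZl.
pose hb b := comb kap (mscal (b \o fst) l); pose h := comb kap l.
have Mhb b : M (hb b) by exact: M_comb.
set S := \sum_(b <- bs) _; pose g := \sum_(b <- bs) A b (hb b).
have sum_dot (t : T) : hdot g t = \sum_(b <- bs) hdot (A b (hb b)) t.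
  rewrite /g; elim: (bs) => [|b r IH]; first by rewrite !big_nil hdot0l.
  by rewrite !big_cons hdotDl IH.
have gh : hdot g h = S.
  rewrite sum_dot; apply: eq_big_seq => b bin; rewrite hdot_norm.
  rewrite /h dot_comb_proj; last exact: (AP b bin).2.
  by rewrite Akt // -(dot_comb_proj _ (Mhb b)).
have S0 : 0 <= S by apply: sumr_ge0 => b _; rewrite exprn_ge0.
have gw l' : hdot g (comb kt l') + (hdot g (comb kt l'))^* <= S + `|comb kt l'| ^+ 2.
  apply: le_trans (lerD (lexx S) (factor_row_contractive l')).
  rewrite sum_dot rmorph_sum /= -!big_split /= !big_seq; apply: ler_sum => b bin.
  rewrite Akt //; set w := comb kt _; rewrite -subr_ge0.
  rewrite (_ : _ - _ = `|hb b - w| ^+ 2) ?exprn_ge0 //.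
  rewrite [`|hb b - w| ^+ 2]hdot_norm hdotBl !hdotBr !hdot_norm (hdotC w (hb b)); ring.
apply: (@le_small_mul _ _ _ (`|h| *+ 2 + 1 + `|g| *+ 2)).
  by rewrite !addr_ge0 ?mulrn_wge0.
move=> d d0 d1.
have [l' hl'] := kernel_tensor_dense h d0.
set w := comb kt l' in hl'.
have wh : `|w| <= `|h| + d.
  by rewrite -(subrK h w) addrC (le_trans (ler_normD _ _)) // lerD2l distrC.
have gd : hdot g h + (hdot g h)^* <= S + `|w| ^+ 2 + `|g| * d *+ 2.
  have -> : h = w + (h - w) by rewrite addrC subrK.
  rewrite hdotDr rmorphD /= addrACA lerD ?gw //.
  rewrite (le_trans (conj_add_le _)) // lerMn2r /= (le_trans (hdot_cs _ _)) //.
  by rewrite ler_wpM2l.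
move: gd; rewrite gh (CrealP (ger0_real S0)) -addrA lerD2l => /le_trans; apply.
rewrite mulrDl [leRHS]addrA lerD //; last by rewrite mulrnAl.
apply: le_trans (_ : (`|h| + d) ^+ 2 <= _).
  by rewrite lerXn2r ?nnegrE ?addr_ge0 // ltW.
rewrite sqrrD -addrA lerD2l mulrDl mul1r mulrnAl lerD2l.
by rewrite expr2 ger_pMr.
Qed.

End Invariant.

Hypothesis s0 : psd_kernel s.

(** At finitely many points 1 - 1/s is the sum of b b^* over a Cholesky
    factorization, so that the form of the quotient kernel is the difference
    of the two sides of [row_contractive]. *)
Lemma defect_psd : psd_kernel (fun x y => 1 - (s x y)^-1) ->
  Mult_invariant Hs M ->
  psd_kernel (fun p q => gram kap p q / s q.1 p.1).
Proof.
move=> G0 M_inv n p c; pose x i := (p i).1.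
have [bs [bs0 bsx]] := cholesky x G0.
pose l := [seq (c i, p i) | i <- enum 'I_n].
have := row_contractive s0 M_inv bs0 l.
rewrite -subr_ge0; congr (0 <= _).
have -> : \sum_(b <- bs) `|comb kap (mscal (b \o fst) l)| ^+ 2 =
  \sum_(i < n) \sum_(j < n) \sum_(b <- bs)
    ((b (x i))^* * c i * gram kap (p i) (p j) * ((b (x j))^* * c j)^*).
  under eq_bigr => b _.
    rewrite hdot_norm -form_gram /form pair_comb /mscal /l -map_comp big_map big_enum /=.
    under eq_bigr => i _ do rewrite big_map big_enum /=.
    over.
  rewrite exchange_big; apply: eq_bigr => i _.
  by rewrite exchange_big.
rewrite hdot_norm -form_gram /form pair_comb /l big_map big_enum /= -sumrB.
apply: eq_bigr => i _; rewrite big_map big_enum /= -sumrB; apply: eq_bigr => j _.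
set Y := gram kap (p i) (p j).
have -> : \sum_(b <- bs) (b (x i))^* * c i * Y * ((b (x j))^* * c j)^* =
    (\sum_(b <- bs) b (x j) * (b (x i))^*) * (c i * Y * (c j)^*).
  rewrite mulr_suml; apply: eq_bigr => b _.
  by rewrite rmorphM /= conjCK; ring.
by rewrite -bsx; ring.
Qed.

Hypothesis Q0 : psd_kernel (fun p q => gram kap p q / s q.1 p.1).

(** Let F be the Hilbert space of the kernel K_M / s, with vectors theta, and
    let Phi x be the adjoint of u |-> theta (x, u).  Then K_M (x, y) is
    Phi x s(x, y) (Phi y)^*, which says that M_Phi composed with its adjoint is the
    projection P: the adjoint V^* sends the kernel tensor at p to eta p, and
    the Gram matrix of eta equals that of kap = P kt.  Hence V is a
    contraction into M that hits every m of M from a vector of norm at most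
    |m|. *)
Lemma beurling_factor :
  exists (F : hilbertType R) (HsF : rkhs_tensor Hs F) (Phi : X -> {linear F -> E}),
    [/\ forall x, continuous (Phi x),
        multiplier (tensor_eval HsF) (tensor_eval T) Phi,
        partial_isometry (mulop (tensor_eval HsF) (tensor_eval T) Phi) &
        M = range (mulop (tensor_eval HsF) (tensor_eval T) Phi)].
Proof.
have [F [theta [thetaE _]]] := kolmogorov Q0.
have [HsF] := rkhs_tensor_exists Hs F.
exists F, HsF.
have sxx x : 0 < s x x.
  have /psd_kernelP/(_ [:: (1, x)]) := s0.
  by rewrite form11 conjC1 !mul1r lt_def s_neq0.
have theta_le x (l : seq (C * E)) :
    `|comb (fun u => theta (x, u)) l| <=
    sqrtC (s x x)^-1 * `|rkhs_kernel Hk x| * `|comb id l|.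
  (* the same combination, placed at the point x *)
  pose lx := [seq (p.1, (x, p.2)) | p <- l].
  have lxE (U : lmodType C) (f : X * E -> U) :
      comb (fun u => f (x, u)) l = comb f lx.
    by rewrite /comb /lx big_map.
  rewrite -mulrA -(tens_norm T) -(tens_comb_r T).
  have -> : comb (fun u => tens T (rkhs_kernel Hk x) u) l = comb kt lx.
    by rewrite -(lxE _ kt).
  apply: le_trans (_ : sqrtC (s x x)^-1 * `|comb kap lx| <= _); last first.
    by rewrite ler_wpM2l ?sqrtC_ge0 ?invr_ge0 ?(ltW (sxx x)) // norm_comb_proj.
  rewrite lxE -ler_sqr ?nnegrE ?mulr_ge0 ?sqrtC_ge0 ?invr_ge0 ?(ltW (sxx x)) //.
  rewrite exprMn sqrtCK !hdot_norm -!form_gram /form !pair_comb.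
  rewrite /lx !big_map mulr_sumr le_eqVlt; apply/orP; left; apply/eqP.
  apply: eq_bigr => p _; rewrite !big_map mulr_sumr; apply: eq_bigr => q _ /=.
  by rewrite {1}/gram thetaE /=; ring.
have /choice[Phi0 Phi0P] : forall fx : F * X, exists g : E,
    (forall u, hdot g u = hdot fx.1 (theta (fx.2, u))) /\
    `|g| <= sqrtC (s fx.2 fx.2)^-1 * `|rkhs_kernel Hk fx.2| * `|fx.1|.
  move=> [f x] /=.
  have [||g [_ gE gc]] := @riesz_family _ _ _ id (fun u => hdot f (theta (x, u)))
     (sqrtC (s x x)^-1 * `|rkhs_kernel Hk x| * `|f|).
  - by rewrite !mulr_ge0 // sqrtC_ge0 invr_ge0 ltW.
  - move=> l; rewrite -(hdot_combr (fun u => theta (x, u))).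
    by rewrite (le_trans (hdot_cs _ _)) // [leRHS]mulrAC mulrC ler_wpM2r.
  by exists g.
pose Phi1 x f := Phi0 (f, x).
have Phi1E x f u : hdot (Phi1 x f) u = hdot f (theta (x, u)).
  exact: (Phi0P (f, x)).1.
have Phi1_lin x : linear (Phi1 x).
  apply: (linear_total (@total_id _ E) (Phi1E x)) => u a f g.
  by rewrite hdotDl hdotZl.
pose Phi x : {linear F -> E} := linear_pack (Phi1_lin x).
exists Phi.
pose eta p := tens HsF (rkhs_kernel Hs p.1) (theta p).
have eta_gram p q : gram eta p q = gram kap p q.
  rewrite {1}/gram tens_dot rkhs_kernel_dot thetaE.
  by rewrite mulrCA mulfV ?mulr1.
have eta_norm l : `|comb eta l| = `|comb kap l|.
  apply/eqP; rewrite -(eqrXn2 (n := 2)) // !hdot_norm -!form_gram.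
  by rewrite /form !pair_comb; under eq_bigr do under eq_bigr do rewrite eta_gram.
have Vex (f : HsF) : exists g : T, (forall p, hdot g (kt p) = hdot f (eta p)) /\
    `|g| <= `|f|.
  have [||g [_ gE gc]] := @riesz_family _ _ _ kt (fun p => hdot f (eta p)) `|f|.
  - by [].
  - move=> l; rewrite -hdot_combr (le_trans (hdot_cs _ _)) // ler_wpM2l //.
    by rewrite eta_norm norm_comb_proj.
  by exists g.
have evV (f : HsF) (g : T) : (forall p, hdot g (kt p) = hdot f (eta p)) ->
    forall x, tensor_eval T g x = Phi x (tensor_eval HsF f x).
  move=> gE x; apply: (total_eq (@total_id _ E)) => u.
  by rewrite tensor_eval_dot gE /= Phi1E tensor_eval_dot.
have PhiM : multiplier (tensor_eval HsF) (tensor_eval T) Phi.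
  by move=> f; have [g [gE _]] := Vex f; exists g; apply: evV.
set V := mulop _ _ _.
have VP f : (forall p, hdot (V f) (kt p) = hdot f (eta p)) /\ `|V f| <= `|f|.
  have [g [gE gf]] := Vex f; suff -> : V f = g by [].
  by apply: tensor_eval_inj => x; rewrite mulop_tensorE // -(evV _ _ gE).
have V_lin : linear V.
  apply: (linear_total (@kernel_tensor_total _ _ _ _ _ T) (fun f => (VP f).1)).
  by move=> p a f g; rewrite hdotDl hdotZl.
have VM f : M (V f).
  (* t = V f - P (V f) is orthogonal to M; approximate it by comb kt l, whose
     projection comb kap l has norm at most d, and so has comb eta l *)
  suff -> : V f = P (V f) by [].
  apply/subr0_eq; set t := _ - _.
  have tM m : M m -> hdot t m = 0 by move=> Mm; rewrite hdotBl PE // subrr.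
  apply: hdot_eq0; rewrite {2}/t hdotBr (tM _ (PM _)) subr0 hdotC.
  apply/eqP; rewrite conjC_eq0; apply/eqP.
  apply: (@small_mul_eq0 _ _ _ (`|V f| + `|f|)); first by rewrite addr_ge0.
  move=> d d0 _.
  have [l tl] := kernel_tensor_dense t d0.
  have ld : `|comb kap l| <= d.
    apply: norm_le_dot; last exact: ltW.
    have Ml := M_comb l.
    rewrite hdot_norm -[leLHS]ger0_norm; last by rewrite -hdot_norm exprn_ge0.
    rewrite (dot_comb_proj _ Ml) -[hdot _ _]subr0.
    have <- : hdot (comb kap l) t = 0 by rewrite hdotC tM // conjC0.
    by rewrite -hdotBr (le_trans (hdot_cs _ _)) // mulrC distrC ler_wpM2r.
  rewrite -(subrK (comb kt l) t) hdotDr (le_trans (ler_normD _ _)) // mulrDl lerD //.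
    by rewrite (le_trans (hdot_cs _ _)) // ler_wpM2l.
  have -> : hdot (V f) (comb kt l) = hdot f (comb eta l).
    by rewrite !hdot_combr; congr (pair _ l); apply/funext => p; rewrite (VP f).1.
  by rewrite (le_trans (hdot_cs _ _)) // ler_wpM2l // eta_norm.
have V_onto m : M m -> exists2 f, V f = m & `|f| <= `|m|.
  move=> Mm.
  have [||f [_ fE fm]] := @riesz_family _ _ _ eta (fun p => hdot m (kt p)) `|m|.
  - by [].
  - move=> l; rewrite -hdot_combr -(dot_comb_proj _ Mm) eta_norm.
    exact: hdot_cs.
  exists f => //; apply: (total_eq (@kernel_tensor_total _ _ _ _ _ T)) => p.
  by rewrite (VP f).1 fE.
split => //.
- move=> x; apply: (@bounded_continuous _ _ _ (Phi1 x)
    (sqrtC (s x x)^-1 * `|rkhs_kernel Hk x|)) => //.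
    by rewrite mulr_ge0 // sqrtC_ge0 invr_ge0 ltW.
  by move=> f; exact: (Phi0P (f, x)).2.
- split=> //.
    by apply: (@bounded_continuous _ _ _ V 1) => // f; rewrite mul1r (VP f).2.
  move=> f fker; apply/eqP; rewrite eq_le (VP f).2 /=.
  have [f0 f0E f0f] := V_onto _ (VM f).
  apply: norm_le_dot => //.
  (* f - f0 is in the kernel of V, hence |f|^2 = <f, f0> <= |f| |V f| *)
  have : hdot f (f - f0) = 0.
    by apply: fker; rewrite addrC -scaleN1r V_lin f0E scaleN1r addrC subrr.
  rewrite hdotBr => /subr0_eq ff0.
  rewrite hdot_norm ff0 -[leLHS]ger0_norm; last by rewrite -ff0 -hdot_norm exprn_ge0.
  by rewrite (le_trans (hdot_cs _ _)) // mulrC ler_wpM2r.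
- apply/seteqP; split=> [m /V_onto[f <- _]|_ [f _ <-]]; last exact: VM.
  by exists f.
Qed.

End Main.

Local Open Scope complex_scope.

Theorem theorem1p1 (R : realType) (X : Type) (k s : X -> X -> R[i])
    (k_kernel : psd_kernel k) (s_cnp : normalized_cnp s)
    (ks_kernel : psd_kernel (fun x y => k x y / s x y))
    (Hk : rkhs k) (Hs : rkhs s) (E : hilbertType R) (HkE : rkhs_tensor Hk E)
    (M : set HkE) (M_closed : closed_subspace M)
    (M_neq0 : exists2 t, M t & t != 0) :
  Mult_invariant Hs M <->
  exists (F : hilbertType R) (HsF : rkhs_tensor Hs F)
         (Phi : X -> {linear F -> E}),
    [/\ forall x, continuous (Phi x),
        multiplier (tensor_eval HsF) (tensor_eval HkE) Phi,
        partial_isometry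
          (mulop (tensor_eval HsF) (tensor_eval HkE) Phi) &
        M = range (mulop (tensor_eval HsF)
                         (tensor_eval HkE) Phi)].
Proof.
have [s0 _ s_neq0 G0] := s_cnp; split=> [M_inv|[F [HsF [Phi [_ PhiM _ ->]]]]].
  have /choice[P PP] : forall t : HkE, exists p : HkE,
      M p /\ forall m, M m -> hdot p m = hdot t m.
    by move=> t; have [p] := orthogonal_projection t M_closed; exists p.
  have PM t := (PP t).1; have PE t := (PP t).2.
  apply: (@beurling_factor _ _ k s _ Hk Hs E HkE M M_closed P) => //.
  exact: (defect_psd _ _ _ _ _ _ G0 M_inv).
exact: range_invariant.
Qed.
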